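(* Let $G=(V,E)$ be a finite connected graph and let $\beta\in\mathcal{P}_+(E)$. Consider the problem of minimizing $\sum_{\gamma\in\Gamma}\sigma[\gamma]$ (which equals $|V|^{-1}\det{}' L_\sigma$) over all $\sigma\in\mathbb{R}^E_{>0}$ satisfying $\prod_{e\in E}\sigma(e)^{\beta(e)}=1$. The determinant in this problem is bounded away from zero (i.e. the infimum is strictly positive) if and only if $G$ is $\beta$-dense. A minimizing choice of $\sigma$ exists if and only if $G$ is $\beta$-dense and every biconnected component of $G$ is strictly $\beta$-dense.
   Context: $G=(V,E)$ is a finite connected undirected graph; multi-edges are allowed, self-loops are not. $\Gamma$ is the set of all spanning trees of $G$ (viewed as edge sets). $\mathcal{P}_+(E)$ is the set of strictly positive probability mass functions on $E$. For $\sigma\in\mathbb{R}^E_{>0}$, $\sigma[\gamma]=\prod_{e\in\gamma}\sigma(e)$. $L_\sigma$ is the weighted graph Laplacian and $\det{}'L_\sigma$ is the product of its $|V|-1$ positive eigenvalues; by Kirchhoff's matrix tree theorem $\det{}'L_\sigma=|V|\sum_{\gamma\in\Gamma}\sigma[\gamma]$. For a connected graph $K$, $\mathcal{S}(K)$ is the family of all connected subgraphs $H=(V_H,E_H)$ of $K$ with $|E_H|\ge 1$ that are edge-induced, i.e. obtained by removing all edges of $K$ not in $E_H$ and deleting any vertices of degree zero. For $H\in\mathcal{S}(G)$, $\theta_\beta(H)=\beta(E_H)/(|V_H|-1)$, where $\beta(E_H)=\sum_{e\in E_H}\beta(e)$. A graph $K$ (either $G$ or a biconnected component of $G$, with $\beta$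 restricted to its edges) is $\beta$-dense if $\theta_\beta(H)\le\theta_\beta(K)$ for all $H\in\mathcal{S}(K)$, and strictly $\beta$-dense if $\theta_\beta(H)<\theta_\beta(K)$ for all $H\in\mathcal{S}(K)$ with $H\ne K$; rescaling $\beta$ by a positive constant does not affect these conditions. Biconnected components are the maximal (vertex-)biconnected subgraphs of $G$ with at least one edge (the blocks of $G$; a bridge is a block). *)

(* Defs.v *)
From mathcomp Require Import all_boot all_order all_algebra.
From mathcomp Require Import boolp classical_sets fsbigop reals exp.

Set Implicit Arguments.
Unset Strict Implicit.
Unset Printing Implicit Defensive.

Import Order.TTheory GRing.Theory Num.Theory.

Local Open Scope ring_scope.

(* Parallel edges are distinct elements of [edge G] with the same set of ends;
   [card_ends] excludes self-loops. *)
Record multigraph := Multigraph {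
  vertex : finType;
  edge : finType;
  ends : edge -> {set vertex};
  card_ends : forall e, #|ends e| = 2%N }.

Record subgraph (G : multigraph) := Subgraph {
  verts : {set vertex G};
  edges : {set edge G};
  ends_sub : [forall e in edges, ends e \subset verts] }.

Lemma whole_ends_sub (G : multigraph) :
  [forall e in [set: edge G], ends e \subset [set: vertex G]].
Proof. by apply/forall_inP => e _; apply: finset.subsetT. Qed.

Definition whole (G : multigraph) : subgraph G := Subgraph (whole_ends_sub G).

Definition adj (G : multigraph) (F : {set edge G}) : rel (vertex G) :=
  fun x y => [exists e in F, ends e == [set x; y]].

(* The graph with vertex set [W] and edge set [F] is (nonempty and) connected;
   this is only used when the ends of the edges in [F] belong to [W]. *)
Definition connected_on (G : multigraph) (W : {set vertex G})
    (F : {set edge G}) : bool :=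
  (W != finset.set0) && [forall x in W, forall y in W, connect (adj F) x y].

Definition connected_sub (G : multigraph) (K : subgraph G) : bool :=
  connected_on (verts K) (edges K).

(* A cycle v_1 e_1 v_2 e_2 ... v_k e_k v_1 is the list of the pairs (v_i, e_i);
   two parallel edges form a cycle with k = 2. *)
Definition graph_cycle (G : multigraph) (c : seq (vertex G * edge G)) : bool :=
  [&& c != [::], uniq (unzip1 c), uniq (unzip2 c) &
      cycle (fun p q => ends p.2 == [set p.1; q.1]) c].

Definition acyclic (G : multigraph) (F : {set edge G}) : Prop :=
  forall c, graph_cycle c -> ~ {subset unzip2 c <= F}.

Definition spanning_trees (G : multigraph) : {set {set edge G}} :=
  [set T : {set edge G} | connected_on [set: vertex G] T & `[< acyclic T >]].

(* The condition on [verts H] says that H is edge-induced (no isolated vertex);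
   in particular H is determined by its edges. *)
Definition conn_subgraphs (G : multigraph) (K H : subgraph G) : Prop :=
  [/\ edges H \subset edges K, (1 <= #|edges H|)%N,
      verts H = (\bigcup_(e in edges H) ends e)%SET & connected_sub H].

(* Vertex-biconnected: connected and without cut vertex; a single edge with its
   two ends is biconnected. *)
Definition biconnected (G : multigraph) (K : subgraph G) : Prop :=
  connected_sub K /\
  forall v, v \in verts K ->
    connected_on (verts K :\ v) [set e in edges K | v \notin ends e].

Definition block (G : multigraph) (K : subgraph G) : Prop :=
  [/\ biconnected K, (1 <= #|edges K|)%N &
      forall K' : subgraph G, biconnected K' ->
        verts K \subset verts K' -> edges K \subset edges K' -> K' = K].

Definition positive_pmf (R : realType) (E : finType) (beta : E -> R) : Prop :=
  (forall e, 0 < beta e) /\ \sum_e beta e = 1.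

Definition theta (R : realType) (G : multigraph) (beta : edge G -> R)
    (H : subgraph G) : R :=
  (\sum_(e in edges H) beta e) / (#|verts H|%:R - 1).

Definition beta_dense (R : realType) (G : multigraph) (beta : edge G -> R)
    (K : subgraph G) : Prop :=
  forall H, conn_subgraphs K H -> theta beta H <= theta beta K.

Definition strictly_beta_dense (R : realType) (G : multigraph)
    (beta : edge G -> R)
    (K : subgraph G) : Prop :=
  forall H, conn_subgraphs K H -> H <> K -> theta beta H < theta beta K.

Definition tree_sum (R : realType) (G : multigraph) (sigma : edge G -> R) : R :=
  \sum_(T in spanning_trees G) \prod_(e in T) sigma e.

Definition feasible (R : realType) (G : multigraph) (beta : edge G -> R) :
    set (edge G -> R) :=
  [set sigma | (forall e, 0 < sigma e) /\
               \prod_e (sigma e `^ beta e) = 1]%classic.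

Definition laplacian (R : realType) (G : multigraph) (sigma : edge G -> R) :
    'M[R]_#|vertex G| :=
  \matrix_(i, j)
    if i == j then \sum_(e | enum_val i \in ends e) sigma e
    else - \sum_(e | ends e == [set enum_val i; enum_val j]) sigma e.

(* Product of the positive eigenvalues, each counted with its algebraic
   multiplicity. *)
Definition det' (R : realType) (n : nat) (A : 'M[R]_n) : R :=
  \big[*%R/1]_(x \in [set x | eigenvalue A x /\ 0 < x]%classic)
    x ^+ mup x (char_poly A).

(* Main.v *)
Require Import Defs.
From mathcomp Require Import all_boot all_order all_algebra.
From mathcomp Require Import perm complex.
From mathcomp Require Import boolp classical_sets functions fsbigop reals.
From mathcomp Require Import interval_inference set_interval topology
  normedtype.
From mathcomp Require Import derive sequences exp.
From mathcomp Require Import zify ring lra.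
From mathcomp.boot Require Import fintype finset.

(** Edges are encoded by the vectors [dl x - dl y] in the space of functions on
the vertices, so that the graphic matroid becomes a family of vectors:
connectivity is membership in a span ([inc_connect]), spanning trees are bases
([spanning_treesP]) and a connected subgraph with vertex set [W] has rank
[#|W| - 1] ([rk_connected_on]).

The first claim is Kirchhoff's theorem. A reduced Laplacian is a product of two
reduced incidence matrices; Cauchy-Binet expands its determinant over edge
sets of size [#|V| - 1], whose minors are [1] or [-1] for trees, an integer
inverse being given by the paths from the root, and [0] otherwise
([reduced_det]). The Laplacian
being symmetric and positive semidefinite with zero row sums, its characteristic
polynomial splits over the reals and is ['X] times a polynomial whose value at
zero is, up to sign, [#|V|] times the reduced determinant ([det'_zero_sums]).

For the two other claims write [sigma = exp s] and rescale [beta] to weights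
[wt] of total mass [r = #|V| - 1]. Dividing the tree sum by [exp (sum wt s)],
which is [1] on feasible points, gives a sum [tsum s] of exponentials of
[excess s T] that does not change when a constant is added to [s]. Every point
being feasible up to a constant, the problem is to minimise [tsum] without
constraint. Splitting edge sets into components shows
that [beta]-density of [G] means that [wt F <= rk F] for all edge sets [F]
([beta_denseP]). Under this condition the greedy spanning tree for [s] has
nonnegative excess, by Abel summation along the decreasing order of [s]
([greedy_basis]); hence the infimum is at least one. If instead
[wt F > rk F], no spanning tree has more than [rk F] edges in [F], and
increasing [s] on [F] drives the sum to zero.

For the existence of a minimiser, the point is that blocks are the direct
summands of the matroid. A block has no ear, so its span meets the span of its
complement trivially ([block_direct]); it follows that under density a block
has [wt] equal to its rank, and that translating [s] on a block does not
change [tsum s]. If moreover all blocks are strictly dense, a set of edges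
  cutting
a block has slack bounded below, so that by the greedy argument [tsum s]
  controls the
oscillation of [s] on each block; after translations [s] may be confined to a
box, where a minimum exists by compactness. Conversely, if some connected proper
[H] in a block [K] violates strictness, minimality along the direction of [H]
forces every spanning tree to have exactly [rk H] edges in [H], which makes [H]
  a
direct summand; but a connected proper subgraph of a biconnected graph has an
ear ([biconnected_ear]), which contradicts this. *)

Set Implicit Arguments.
Unset Strict Implicit.
Unset Printing Implicit Defensive.

Import Order.TTheory GRing.Theory Num.Theory.
Import numFieldNormedType.Exports.

Local Open Scope ring_scope.

(** * Ranks of families of vectors *)

Section VectorRank.
Context {K : fieldType} {vT : vectType K} {E : finType} (b : E -> vT).
Implicit Types F I J : {set E}.

(** The span and the rank of the subfamily indexed by a set. *)
Definition spn F : {vspace vT} := (\sum_(e in F) <[b e]>)%VS.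
Definition rk F : nat := \dim (spn F).

Lemma mem_spn F e : e \in F -> b e \in spn F.
Proof. by move=> eF; rewrite memvE (sumv_sup e). Qed.

Lemma spn_sub F (W : {vspace vT}) :
  (forall e, e \in F -> b e \in W) -> (spn F <= W)%VS.
Proof. by move=> h; apply/subv_sumP => e /h; rewrite memvE. Qed.

Lemma spnS F F' : F \subset F' -> (spn F <= spn F')%VS.
Proof. by move=> /subsetP s; apply: spn_sub => e /s; apply: mem_spn. Qed.

Lemma spn0 : spn set0 = 0%VS.
Proof. by rewrite /spn big_set0. Qed.

Lemma spnU F F' : spn (F :|: F') = (spn F + spn F')%VS.
Proof.
apply/eqP; rewrite eqEsubv subv_add !spnS ?subsetUl ?subsetUr // !andbT.
apply: spn_sub => e; rewrite inE => /orP[] /mem_spn h.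
  by apply: (subvP (addvSl _ _)).
by apply: (subvP (addvSr _ _)).
Qed.

Lemma spn1 e : spn [set e] = <[b e]>%VS.
Proof. by rewrite /spn big_set1. Qed.

Lemma spnU1 F e : spn (e |: F) = (<[b e]> + spn F)%VS.
Proof. by rewrite spnU spn1. Qed.

Lemma rkS F F' : F \subset F' -> (rk F <= rk F')%N.
Proof. by move=> s; apply/dimvS/spnS. Qed.

Lemma rkU_leq F F' : (rk (F :|: F') <= rk F + rk F')%N.
Proof. by rewrite /rk spnU; case: (dimv_add_leqif (spn F) (spn F')). Qed.

Lemma rk_leq_card F : (rk F <= #|F|)%N.
Proof.
apply: leq_trans (dimv_leq_sum _ _ _) _; rewrite -sum1_card leq_sum // => e _.
by rewrite dim_vline leq_b1.
Qed.

(** Adding a vector outside of a subspace increases the dimension by one. *)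
Lemma dim_addv_line (W : {vspace vT}) v :
  v \notin W -> \dim (<[v]> + W) = (\dim W).+1.
Proof.
move=> vW; have v0 : v != 0 by apply: contraNneq vW => ->; rewrite mem0v.
rewrite dimv_disjoint_sum ?dim_vline ?v0 //.
apply/eqP; rewrite -subv0; apply/subvP => u /memv_capP[/vlineP[k ->]].
have [->|k0] := eqVneq k 0; first by move=> _; rewrite scale0r mem0v.
move/(memvZ k^-1); rewrite scalerA mulVf // scale1r => h.
by rewrite h in vW.
Qed.

Lemma rkU1 F e : b e \notin spn F -> rk (e |: F) = (rk F).+1.
Proof. by move=> h; rewrite /rk spnU1 dim_addv_line. Qed.

Lemma spnU1_id F e : b e \in spn F -> spn (e |: F) = spn F.
Proof. by move=> h; rewrite spnU1; apply/addv_idPr; rewrite -memvE. Qed.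

(** The index set [I] is independent when its rank is its cardinality. *)
Definition indep I := rk I == #|I|.

Lemma indep0 : indep set0.
Proof. by rewrite /indep /rk spn0 dimv0 cards0. Qed.

Lemma indepS I J : I \subset J -> indep J -> indep I.
Proof.
move=> sIJ /eqP iJ; rewrite /indep eqn_leq rk_leq_card /=.
have e : I :|: (J :\: I) = J by rewrite setDE setUIr setUCr setIT (setUidPr
  sIJ).
have := rkU_leq I (J :\: I); rewrite e iJ -(cardsID I J) (setIidPr sIJ) => h.
by rewrite -(leq_add2r #|J :\: I|) (leq_trans h) // leq_add2l rk_leq_card.
Qed.

Lemma indepU1 I e : indep I -> b e \notin spn I -> indep (e |: I).
Proof.
move=> /eqP iI eI; rewrite /indep rkU1 // iI cardsU1.
by rewrite (contraNN _ eI) // => /mem_spn.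
Qed.

Lemma indep_notin I e : indep I -> e \in I -> b e \notin spn (I :\ e).
Proof.
move=> iI eI; apply/negP => /spnU1_id; rewrite setD1K // => h.
have := rk_leq_card (I :\ e); rewrite /rk -h -/(rk I) (eqP iI).
by rewrite (cardsD1 e I) eI add1n ltnn.
Qed.

Lemma indepP I : (forall e, e \in I -> b e \notin spn (I :\ e)) -> indep I.
Proof.
move=> h.
suff H : forall J : {set E}, J \subset I -> indep J by apply: H.
move=> J; move: {2}#|J| (leqnn #|J|) => n; elim: n J => [|n IH] J.
  by rewrite leqn0 cards_eq0 => /eqP -> _; apply: indep0.
have [->|[e eJ]] := set_0Vmem J; first by rewrite indep0.
rewrite (cardsD1 e) eJ ltnS => cJ sJ; rewrite -(setD1K eJ); apply: indepU1.
  by apply: IH => //; apply: subset_trans sJ; apply: subD1set.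
apply: contraNN (h e (subsetP sJ _ eJ)); apply/subvP/spnS/setSD/sJ.
Qed.

(** An independent set extends to a basis of any set containing it. *)
Lemma indep_extend I F : I \subset F -> indep I ->
  exists J, [/\ I \subset J, J \subset F, indep J & spn J = spn F].
Proof.
move: {2}(#|F| - #|I|)%N (leqnn (#|F| - #|I|)) => n.
elim: n I => [|n IH] I hn sIF iI.
  exists I; split=> //; congr spn; apply/eqP; rewrite eqEcard sIF.
  by rewrite -subn_eq0 -leqn0.
have [h|/subvPn[v vF vI]] := boolP (spn F <= spn I)%VS.
  by exists I; split=> //; apply/eqP; rewrite eqEsubv spnS.
have [e eF eI] : exists2 e, e \in F & b e \notin spn I.
  apply/exists_inP; apply: contraNT vI; rewrite negb_exists_in.
  move=> /forall_inP h; apply: (subvP _ v vF); apply: spn_sub => e /h.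
  by rewrite negbK.
have eNI : e \notin I by apply: contraNN eI => /mem_spn.
have sI' : e |: I \subset F by rewrite subUset sub1set eF.
have [|J [sJ JF iJ eJ]] := IH (e |: I) _ sI' (indepU1 iI eI).
  by rewrite cardsU1 eNI add1n subnS -ltnS; case: (#|F| - #|I|)%N hn.
by exists J; split=> //; apply: subset_trans sJ; apply: subsetUr.
Qed.

(** A set whose span meets the span of its complement trivially splits the
rank of every set. *)
Lemma rk_split B F : (spn B :&: spn (~: B) = 0)%VS ->
  rk F = (rk (F :&: B) + rk (F :\: B))%N.
Proof.
move=> h; rewrite -[in LHS](setID F B) /rk spnU dimv_disjoint_sum //.
apply/eqP; rewrite -subv0 -h; apply: capvS; apply: spnS.
  exact: subsetIr.
by rewrite setDE subsetIr.
Qed.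

(** If all bases of the whole family have [rk B] elements in [B], then [B]
is a direct summand. *)
Lemma bases_split B :
  (forall J, indep J -> spn J = spn setT -> #|J :&: B| = rk B) ->
  (spn B :&: spn (~: B) = 0)%VS.
Proof.
move=> h; apply/eqP; rewrite -dimv_eq0.
have [I [_ sI iI eI]] := indep_extend (sub0set (~: B)) indep0.
have [J [sJ _ iJ eJ]] := indep_extend (subsetT I) iI.
have cI : #|I| = rk (~: B) by rewrite -(eqP iI) /rk eI.
have cJ : #|J| = rk [set: E] by rewrite -(eqP iJ) /rk eJ.
have := dimv_sum_cap (spn B) (spn (~: B)).
rewrite -spnU setUCr -!/(rk _) -cI -cJ -(h J iJ eJ) -(cardsID B J).
have : (#|I| <= #|J :\: B|)%N.
  apply: subset_leq_card; rewrite setDE subsetI sJ /=.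
  exact: sI.
lia.
Qed.

(** The greedy algorithm, run on the elements in decreasing order of [s].
Abel summation along that order bounds from below the excess of the weight of
the greedy basis over the [w]-average of [s]; when in addition every set
separating [e1] from [e2] has slack at least [d], the excess controls
[s e1 - s e2]. *)
Lemma greedy_basis (R : realFieldType) (s w : E -> R) (e1 e2 : E) (d : R) :
    0 <= d ->
    (forall F, \sum_(e in F) w e <= (rk F)%:R) ->
    \sum_e w e = (rk [set: E])%:R ->
    (forall F, e1 \in F -> e2 \notin F -> \sum_(e in F) w e + d <= (rk F)%:R) ->
  exists J, [/\ indep J, spn J = spn setT &
    d * (s e1 - s e2) <= \sum_(e in J) s e - \sum_e w e * s e].
Proof.
move=> d0 wle wT wsep.
(* The invariant on an initial segment [l] of the decreasing order: Abel's
   formula with all the values outside of [l] replaced by a lower bound [c];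
   [D l c] is then the drop from [e1] to [e2] already accounted for. *)
pose D (l : seq E) c :=
  if e1 \in l then d * (s e1 - (if e2 \in l then s e2 else c)) else 0.
have main (l : seq E) : uniq l -> pairwise (fun x y => s y <= s x) l ->
  exists J, [/\ indep J, J \subset [set x in l], spn J = spn [set x in l] &
    forall c, (forall x, x \in l -> c <= s x) ->
    D l c + c * ((rk [set x in l])%:R - \sum_(e <- l) w e)
      <= \sum_(e in J) s e - \sum_(e <- l) w e * s e].
  elim/last_ind: l => [_ _|l x IH].
    have e0 : [set x in [::]] = set0 :> {set E} by apply/setP => y;
      rewrite !inE.
    exists set0; rewrite e0; split=> // [|c _]; first exact: indep0.
    by rewrite /D big_set0 !big_nil /rk spn0 dimv0 !subr0 mulr0 addr0.
  rewrite rcons_uniq pairwise_rcons => /andP[xl ul] /andP[/allP hx pl].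
  have [J [iJ sJ eJ hJ]] := IH ul pl.
  have eF : [set y in rcons l x] = x |: [set y in l].
    by apply/setP => y; rewrite !inE mem_rcons inE.
  have step (J' : {set E}) : (\sum_(e in J') s e = \sum_(e in J) s e +
      ((rk [set y in rcons l x])%:R - (rk [set y in l])%:R) * s x) ->
      forall c, (forall y, y \in rcons l x -> c <= s y) ->
      D (rcons l x) c + c * ((rk [set y in rcons l x])%:R -
        \sum_(e <- rcons l x) w e)
      <= \sum_(e in J') s e - \sum_(e <- rcons l x) w e * s e.
    move=> -> c hc; have := hJ (s x) hx.
    have cx : c <= s x by apply: hc; rewrite mem_rcons mem_head.
    have wF : \sum_(e <- rcons l x) w e = \sum_(e in [set y in rcons l x]) w e.
      rewrite big_uniq ?rcons_uniq ?xl //=; by apply: eq_bigl => y; rewrite inE.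
    have := wle [set y in rcons l x]; have := wsep [set y in rcons l x].
    rewrite -wF !inE !mem_rcons !inE.
    rewrite -!cats1 !big_cat /= !big_seq1 /D !mem_cat !inE.
    set r' := (rk _)%:R; set r := (rk _)%:R; set S := \sum_(e in J) _.
    set W := \sum_(e <- l) w e; set V := \sum_(e <- l) _.
    have mono u : 0 <= u -> c * u <= s x * u by move=> u0; apply: ler_wpM2r.
    move=> msep; rewrite -subr_ge0 => /mono m' h.
    have [xe1|ne1] := eqVneq e1 x.
      rewrite xe1 (negPf xl) orbT in msep h *.
      have [xe2|ne2] := eqVneq e2 x; first by rewrite orbT xe2; lra.
      rewrite orbF; rewrite (negPf ne2) /= in msep.
      case: ifP => e2l.
        have : d * (s x - s e2) <= 0 by rewrite mulr_ge0_le0 // subr_le0 hx.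
        lra.
      have /mono : 0 <= r' - (W + w x) - d.
        by rewrite subr_ge0 lerBrDl msep ?eqxx ?e2l.
      lra.
    rewrite !orbF; rewrite (negPf ne1) /= in msep.
    case: ifP => e1l; rewrite e1l /= in h msep; last by lra.
    have [xe2|ne2] := eqVneq e2 x.
      by rewrite orbT; rewrite xe2 (negPf xl) /= in h *; lra.
    rewrite orbF; rewrite (negPf ne2) /= in msep.
    case: ifP => e2l; rewrite e2l /= in h msep; first by lra.
    have /mono : 0 <= r' - (W + w x) - d by rewrite subr_ge0 lerBrDl msep.
    lra.
  have [bx|bx] := boolP (b x \in spn [set y in l]).
    exists J; rewrite eF spnU1_id //; split=> //.
      by apply: subset_trans sJ _; apply: subsetUr.
    rewrite -eF; apply: step; rewrite eF /rk spnU1_id // subrr mul0r addr0 //.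
  exists (x |: J); split.
  - by apply: indepU1 => //; rewrite eJ.
  - by rewrite eF setUS.
  - by rewrite eF !spnU1 eJ.
  - apply: step; rewrite eF rkU1 // big_setU1 /=; last first.
      by apply: contraNN xl => /(subsetP sJ); rewrite inE.
    by rewrite -natr1 addrC; congr (_ + _); ring.
pose l := sort (fun x y => s y <= s x) (enum E).
have ml x : x \in l by rewrite mem_sort mem_enum.
have eT : [set x in l] = setT by apply/setP => x; rewrite !inE ml.
have sumT (f : E -> R) : \sum_(e <- l) f e = \sum_e f e.
  rewrite big_uniq ?sort_uniq ?enum_uniq //=; apply: eq_bigl => x; exact: ml.
have [||J [iJ _ eJ hJ]] := main l; first by rewrite sort_uniq enum_uniq.
  rewrite -sorted_pairwise; last by move=> y x z h1 h2; apply: le_trans h2 h1.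
  by apply: sort_sorted => x y; apply: le_total.
exists J; rewrite -eT; split=> //.
(* On the whole family the coefficient of [c] vanishes; any lower bound of [s]
   will do. *)
have := hJ (- \sum_x `|s x|); rewrite /D !ml !sumT eT wT subrr mulr0 addr0.
apply=> x _; rewrite lerNl (bigD1 x) //= -[X in X <= _]addr0 lerD ?sumr_ge0 //.
by rewrite -normrN ler_norm.
Qed.

End VectorRank.

(** * The incidence vectors of a graph *)

Section Incidence.
Context {G : multigraph}.
Local Notation V := (vertex G).
Local Notation E := (edge G).
Local Notation vT := {ffun V -> rat^o}.
Implicit Types (F T C : {set E}) (W : {set V}).

Lemma orient_subproof (e : E) :
  exists p : V * V, (p.1 != p.2) && (ends e == [set p.1; p.2]).
Proof.
have /cards2P[x [y [nxy exy]]] : #|ends e| == 2%N by rewrite card_ends.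
by exists (x, y); rewrite /= nxy exy eqxx.
Qed.

(** An arbitrary orientation of the edges. *)
Definition orient e := xchoose (orient_subproof e).

Lemma ends_orient e : ends e = [set (orient e).1; (orient e).2].
Proof. by have /andP[_ /eqP] := xchooseP (orient_subproof e). Qed.

Lemma orient_neq e : (orient e).1 != (orient e).2.
Proof. by have /andP[] := xchooseP (orient_subproof e). Qed.

Lemma orientP e x y : ends e = [set x; y] ->
  orient e = (x, y) \/ orient e = (y, x).
Proof.
rewrite ends_orient; have := orient_neq e; case: (orient e) => a c /= nac h.
have : a \in [set x; y] by rewrite -h !inE eqxx.
have : c \in [set x; y] by rewrite -h !inE eqxx orbT.
have : x \in [set a; c] by rewrite h !inE eqxx.
have : y \in [set a; c] by rewrite h !inE eqxx orbT.
rewrite !inE; do 4!(case/orP=> /eqP ?); subst; rewrite ?eqxx // in nac; by auto.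
Qed.

Lemma adj_sym F : symmetric (adj F).
Proof.
by move=> x y; apply: eq_existsb => e; rewrite [[set x; y]]setUC.
Qed.

Lemma connect_adj_sym F : connect_sym (adj F).
Proof. exact/sym_connect_sym/adj_sym. Qed.

Lemma adjP F x y :
  reflect (exists2 e, e \in F & ends e = [set x; y]) (adj F x y).
Proof.
apply: (iffP exists_inP) => -[e eF]; first by move/eqP; exists e.
by move/eqP; exists e.
Qed.

Lemma adjS F F' x y : F \subset F' -> adj F x y -> adj F' x y.
Proof.
by move=> /subsetP s /adjP[e /s eF ee]; apply/adjP; exists e.
Qed.

Lemma connectS F F' x y :
  F \subset F' -> connect (adj F) x y -> connect (adj F') x y.
Proof. by move=> s; apply: connect_sub => a c /(adjS s) /connect1. Qed.

(** The unit vector of a vertex and the incidence vector of an edge. Ranks do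
not depend on the field of characteristic zero; the rationals are used. *)
Definition dl (x : V) : vT := [ffun y => (y == x)%:R].
Definition inc e : vT := dl (orient e).1 - dl (orient e).2.

Lemma inc_ends e x y (W : {vspace vT}) : ends e = [set x; y] ->
  (inc e \in W) = (dl x - dl y \in W).
Proof. by rewrite /inc => /orientP[->|->] //=; rewrite -memvN opprB. Qed.

Lemma connect_spn F x y : connect (adj F) x y -> dl x - dl y \in spn inc F.
Proof.
case/connectP => p; elim: p x => [|z p IH] x /=.
  by move=> _ ->; rewrite subrr mem0v.
move=> /andP[/adjP[e eF ee] hp] hy.
rewrite -(subrK (dl z) (dl x)) -addrA memvD ?IH //.
by rewrite -(inc_ends _ ee) mem_spn.
Qed.

(** Vectors of the span have zero sum over the sets of vertices that no edge
of the set leaves. *)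
Lemma spn_sum0 F W v :
    (forall e x y, e \in F -> ends e = [set x; y] -> (x \in W) = (y \in W)) ->
  v \in spn inc F -> \sum_(x in W) v x = 0.
Proof.
move=> hW /memv_sumP[c hc ->].
under eq_bigr do rewrite sum_ffunE.
rewrite exchange_big big1 // => e eF.
have /vlineP[k ->] := hc e eF.
under eq_bigr do rewrite !ffunE.
rewrite -mulr_sumr sumrB.
have S a : \sum_(x in W) (x == a)%:R = (a \in W)%:R :> rat.
  case: (boolP (a \in W)) => aW.
    by rewrite (bigD1 a) //= eqxx big1 ?addr0 // => i /andP[_ /negPf ->].
  rewrite big1 // => i iW; case: eqP => // ia.
  by rewrite -ia iW in aW.
by rewrite !S (hW e _ _ eF (ends_orient e)) subrr mulr0.
Qed.

Lemma spn_supp F v x :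
  (forall e, e \in F -> x \notin ends e) -> v \in spn inc F -> v x = 0.
Proof.
move=> h /(@spn_sum0 F [set x]); rewrite big_set1; apply=> e a c eF ee.
by have := h e eF;
  rewrite ee !inE negb_or ![x == _]eq_sym => /andP[/negPf -> /negPf ->].
Qed.

Lemma spn_connect F x y : dl x - dl y \in spn inc F -> connect (adj F) x y.
Proof.
move=> h; apply/negP => /negP nxy.
have : \sum_(z in [set z | connect (adj F) x z]) (dl x - dl y) z = 0.
  apply: (spn_sum0 _ h) => e a c eF ee; rewrite !inE;
    apply/idP/idP => /connect_trans; apply.
    by apply/connect1/adjP; exists e.
  by apply/connect1; rewrite adj_sym; apply/adjP; exists e.
rewrite (bigD1 x) ?inE ?connect0 //= big1 => [|z].
  rewrite !ffunE eqxx addr0; case: eqP => [e|_].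
    by rewrite e connect0 in nxy.
  by rewrite subr0 => /eqP; rewrite oner_eq0.
rewrite !inE !ffunE => /andP[xz /negPf ->]; case: eqP => [e|_];
  last by rewrite subrr.
by rewrite -e xz in nxy.
Qed.

Lemma inc_connect F e x y :
  ends e = [set x; y] -> (inc e \in spn inc F) = connect (adj F) x y.
Proof.
move=> ee; rewrite (inc_ends _ ee); apply/idP/idP.
  exact: spn_connect.
exact: connect_spn.
Qed.

Lemma indep_dl W : indep dl W.
Proof.
apply: indepP => x xW; apply/negP => h.
have : dl x x = 0.
  move: (dl x) h => v /memv_sumP[c hc ->]; rewrite sum_ffunE big1 // => y yW.
  have /vlineP[k ->] := hc y yW; have nxy : y != x by move: yW;
    rewrite !inE => /andP[].
  by rewrite !ffunE [x == y]eq_sym (negPf nxy) scaler0.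
by rewrite ffunE eqxx => /eqP; rewrite oner_eq0.
Qed.

(** A connected graph on [W] has rank [#|W| - 1]. *)
Lemma rk_connected_on F W : (forall e, e \in F -> ends e \subset W) ->
  connected_on W F -> (rk inc F).+1 = #|W|.
Proof.
move=> sF /andP[/set0Pn[x0 x0W] /forall_inP cW].
rewrite -(eqP (indep_dl W)) /rk -(@dim_addv_line _ _ _ (dl x0)); last first.
  apply/negP => h; have : \sum_(x in setT) dl x0 x = 0.
    by apply: (spn_sum0 _ h) => e x y; rewrite !inE.
  rewrite (bigD1 x0) ?inE //= big1 => [|y /andP[_ /negPf nx]];
    rewrite ffunE ?nx //.
  by rewrite eqxx addr0 => /eqP; rewrite oner_eq0.
congr (\dim _); apply/eqP; rewrite eqEsubv subv_add; apply/andP; split.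
  rewrite -memvE mem_spn //=; apply: spn_sub => e eF.
  have := sF e eF; rewrite ends_orient subUset !sub1set => /andP[h1 h2].
  by rewrite memvB // mem_spn.
apply: spn_sub => x xW;
  rewrite -(subrK (dl x0) (dl x)) addrC memv_add ?memv_line //.
by apply: connect_spn; have /forall_inP := cW x xW; apply.
Qed.

End Incidence.

(** * Spanning trees as bases *)

Section Trees.
Context {G : multigraph}.
Local Notation V := (vertex G).
Local Notation E := (edge G).
Implicit Types (F T C : {set E}) (W : {set V}).

(** The relation between consecutive pairs of a cycle in [graph_cycle]. *)
Let step : rel (V * E) := fun p q => ends p.2 == [set p.1; q.1].

(** The edges of a simple path, paired with their origins. A last pair [q]
sitting at the end of the path is left open in order to close up cycles. *)
Lemma path_edges F p x : path (adj F) x p -> uniq (x :: p) ->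
  exists c : seq (V * E), [/\ unzip1 c = belast x p, {subset unzip2 c <= F},
    uniq (unzip2 c), forall e, e \in unzip2 c -> ends e \subset x :: p &
    forall q : V * E, q.1 = last x p -> sorted step (rcons c q)].
Proof.
elim: p x => [|y p IH] x; first by move=> _ _; exists [::].
rewrite [path _ _ _]/= [uniq _]/=.
move=> /andP[/adjP[e eF ee] hp] /andP[xp up].
have [c [c1 cF c2 ce cs]] := IH y hp up.
exists ((x, e) :: c); split=> /=.
- by rewrite c1.
- by move=> e'; rewrite inE => /orP[/eqP -> //|/cF].
- rewrite c2 andbT; apply: contraNN xp => /ce /subsetP; apply.
  by rewrite ee !inE eqxx.
- move=> e'; rewrite inE => /orP[/eqP ->|/ce h].
    by apply/subsetP => z; rewrite ee !inE => /orP[] ->; rewrite ?orbT.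
  by apply: subset_trans h _; apply/subsetP => z; rewrite !inE => ->;
    rewrite orbT.
- move=> q hq; have := cs q hq; case: c c1 {c2 cF ce cs} => [|q1 c] c1 /=.
    move=> _; rewrite andbT /step /= ee.
    by case: p c1 hq {IH xp up hp} => // _ /= ->.
  by move=> ->; rewrite andbT /step /= ee;
    case: p c1 {IH xp up hp hq} => // a p [->].
Qed.

Lemma path_step_connect F c q0 q : path step q0 (rcons c q) ->
  {subset unzip2 c <= F} ->
  exists2 z, ends q0.2 = [set q0.1; z] & connect (adj F) z q.1.
Proof.
elim: c q0 => [|q1 c IH] q0 /=.
  by rewrite andbT => /eqP h _; exists q.1.
move=> /andP[/eqP h0 /IH{}IH] s.
have [|z hz cz] := IH; first by move=> e he; apply: s; rewrite inE he orbT.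
exists q1.1 => //; apply: connect_trans cz; apply/connect1/adjP;
  exists q1.2 => //.
by apply: s; rewrite inE eqxx.
Qed.

(** An edge set is acyclic exactly when its incidence vectors are
independent. *)
Lemma acyclic_indep F : acyclic F <-> indep inc F.
Proof.
split=> [acF|iF c].
  apply: indepP => e eF; apply/negP; rewrite (inc_connect _ (ends_orient e)).
  move: (ends_orient e) (orient_neq e); case: (orient e) => x y /= ee nxy.
  case/connectP => p0 /shortenP[p hp up _] ey; move: ee nxy;
    rewrite ey {p0 ey} => ee nxy.
  have [c [c1 cF c2 _ cs]] := path_edges hp up.
  have sD : F :\ e \subset F by apply: subD1set.
  have cN : e \notin unzip2 c by apply/negP => /cF; rewrite !inE eqxx.
  apply: (acF (rcons c (last x p, e))).
    apply/and4P; split.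
    - by case: (c).
    - by rewrite /unzip1 map_rcons -/(unzip1 c) c1 -lastI.
    - by rewrite /unzip2 map_rcons rcons_uniq -/(unzip2 c) cN.
    - have := cs (last x p, e) erefl; case: c c1 {c2 cF cN cs} => [|q c] c1.
        by case: p c1 nxy {hp up ee} => //=; rewrite eqxx.
      rewrite {1}/sorted [rcons (q :: c) _]/= => h.
      rewrite /= rcons_path h last_rcons /step /= ee setUC.
      by case: p c1 {h hp up nxy ee} => // a p [->].
  move=> e'; rewrite /unzip2 map_rcons mem_rcons inE => /orP[/eqP -> //|].
  by move=> /cF /(subsetP sD).
move=> /and4P[]; case: c => // q c _ u1 u2 hc s.
(* The first edge of a cycle joins two vertices connected by the others. *)
have [|z hz cz] := path_step_connect (F := F :\ q.2) hc.
  move=> e ec; rewrite !inE s /=; last by rewrite inE ec orbT.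
  by rewrite andbT; apply: contraTneq ec => ->; move: u2 => /= /andP[].
have := indep_notin iF (s q.2 (mem_head _ _)).
by rewrite (inc_connect _ hz) connect_adj_sym cz.
Qed.

Hypothesis connG : connected_sub (whole G).

Lemma connected_spn F : connected_on [set: V] F <-> spn inc F = spn inc setT.
Proof.
have [V0 cG] := andP connG; split=> [/andP[_ /forall_inP cF]|eF].
  apply/eqP; rewrite eqEsubv spnS ?subsetT //=; apply: spn_sub => e _.
  rewrite (inc_connect _ (ends_orient e)).
  by have /forall_inP := cF (orient e).1 (in_setT _); apply; rewrite inE.
apply/andP; split=> //; apply/forall_inP => x _; apply/forall_inP => y _.
apply: spn_connect; rewrite eF; apply: connect_spn.
by have /forall_inP/(_ x)/(_ (in_setT _))/forall_inP := cG; apply; rewrite inE.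
Qed.

Lemma spanning_treesP T :
  T \in spanning_trees G <-> indep inc T /\ spn inc T = spn inc setT.
Proof.
rewrite inE; split.
  by move=> /andP[/connected_spn ? /asboolP/acyclic_indep ?].
move=> [iT eT]; apply/andP; split; first exact/connected_spn.
by apply/asboolP/acyclic_indep.
Qed.

Lemma rk_whole : (rk inc [set: E]).+1 = #|V|.
Proof.
rewrite (@rk_connected_on G setT setT) ?cardsT // => e _; exact: subsetT.
Qed.

Lemma card_tree T : T \in spanning_trees G -> (#|T|).+1 = #|V|.
Proof. by move=> /spanning_treesP[/eqP <- eT]; rewrite /rk eT rk_whole. Qed.

(** A connected set of [#|V| - 1] edges is a tree. *)
Lemma tree_of_card T : (#|T|).+1 = #|V| -> connected_on [set: V] T ->
  T \in spanning_trees G.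
Proof.
move=> cT /connected_spn eT; apply/spanning_treesP; split=> //.
by rewrite /indep /rk eT -eqSS rk_whole cT.
Qed.

Lemma tree_extend F : indep inc F ->
  exists2 T, T \in spanning_trees G & F \subset T.
Proof.
move=> /(indep_extend (subsetT F))[T [sFT _ iT eT]].
by exists T => //; apply/spanning_treesP.
Qed.

Lemma tree_meet_leq T F : T \in spanning_trees G -> (#|T :&: F| <= rk inc F)%N.
Proof.
move=> /spanning_treesP[iT _]; have /eqP <- := indepS (subsetIl T F) iT.
exact/rkS/subsetIr.
Qed.

End Trees.

(** * Edge-induced subgraphs and components *)

Section Blocks.
Context {G : multigraph}.
Local Notation V := (vertex G).
Local Notation E := (edge G).
Implicit Types (F T C : {set E}) (W : {set V}) (K H : subgraph G).

(** The vertices met by a set of edges. *)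
Definition cover_ends F : {set V} := (\bigcup_(e in F) ends e)%SET.

Lemma ends_cover F e : e \in F -> ends e \subset cover_ends F.
Proof. by move=> eF; apply: bigcup_sup. Qed.

Lemma cover_endsP F x :
  reflect (exists2 e, e \in F & x \in ends e) (x \in cover_ends F).
Proof. exact: bigcupP. Qed.

(** The nonempty edge sets of connected edge-induced subgraphs. *)
Definition conn_edges C := (C != set0) && connected_on (cover_ends C) C.

Lemma rk_conn_edges C : conn_edges C -> (rk inc C).+1 = #|cover_ends C|.
Proof.
by move=> /andP[_ cC]; apply: rk_connected_on cC => e; apply: ends_cover.
Qed.

Lemma cover_induced F : [forall e in F, ends e \subset cover_ends F].
Proof. by apply/forall_inP => e; apply: ends_cover. Qed.

(** The edge-induced subgraph on a set of edges. *)
Definition induced F : subgraph G := Subgraph (cover_induced F).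

Lemma subgraph_eq K H : verts K = verts H -> edges K = edges H -> K = H.
Proof.
case: K H => [vK eK pK] [vH eH pH] /= ev ee; subst.
by congr Subgraph; apply: bool_irrelevance.
Qed.

Lemma conn_subgraphs_induced K C : C \subset edges K -> conn_edges C ->
  conn_subgraphs K (induced C).
Proof. by move=> sC /andP[C0 cC]; split=> //; rewrite card_gt0. Qed.

Lemma conn_subgraphsP K H : conn_subgraphs K H ->
  [/\ edges H \subset edges K, verts H = cover_ends (edges H) &
      conn_edges (edges H)].
Proof.
move=> [s n ev c]; split=> //; rewrite /conn_edges -card_gt0 n /=.
by rewrite /cover_ends -ev.
Qed.

Lemma ends_subset K e : e \in edges K -> ends e \subset verts K.
Proof. by move: e; apply/forall_inP/ends_sub. Qed.

Lemma in_ends F e x : e \in F -> x \in ends e ->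
  exists2 y, ends e = [set x; y] & y != x.
Proof.
move=> eF; rewrite ends_orient; have := orient_neq e.
case: (orient e) => a c /= nac; rewrite !inE => /orP[] /eqP ->.
  by exists c => //; rewrite eq_sym.
by exists a => //; rewrite setUC.
Qed.

Lemma connected_cover K : connected_sub K -> edges K != set0 ->
  verts K = cover_ends (edges K).
Proof.
move=> /andP[_ /forall_inP cK] /set0Pn[e eK]; apply/eqP; rewrite eqEsubset.
apply/andP; split; last by apply/bigcupsP => e'; apply: ends_subset.
have /subsetP sK := ends_subset eK.
apply/subsetP => x xK.
have aK : (orient e).1 \in verts K by apply: sK; rewrite ends_orient !inE eqxx.
have [xa|nxa] := eqVneq x (orient e).1.
  by apply/cover_endsP; exists e => //; rewrite xa ends_orient !inE eqxx.
have /forall_inP/(_ _ aK)/connectP[[|y p] /=] := cK x xK.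
  by move=> _ ea; rewrite ea eqxx in nxa.
move=> /andP[/adjP[e' e'K ee'] _] _; apply/cover_endsP; exists e' => //.
by rewrite ee' !inE eqxx.
Qed.

Lemma conn_edges_sub K : connected_sub K -> edges K != set0 ->
  conn_edges (edges K).
Proof.
by move=> cK K0; rewrite /conn_edges K0 -(connected_cover cK K0).
Qed.

(** Two edge sets without common vertex have independent spans. *)
Lemma cap_spn_supp F F' v :
  (forall x, (forall e, e \in F -> x \notin ends e) \/
             (forall e, e \in F' -> x \notin ends e)) ->
  v \in spn inc F -> v \in spn inc F' -> v = 0.
Proof.
move=> h vF vF'; apply/ffunP => x; rewrite [RHS]ffunE.
by have [hx|hx] := h x; apply: spn_supp hx _.
Qed.

(** Every nonempty edge set splits off the edges of one of its components. *)
Lemma split_component F : F != set0 ->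
  exists C, [/\ C \subset F, conn_edges C &
    rk inc F = (rk inc C + rk inc (F :\: C))%N].
Proof.
move=> /set0Pn[e0 e0F]; pose x0 := (orient e0).1.
pose C := [set e in F | connect (adj F) x0 (orient e).1].
have connE e x : e \in F -> x \in ends e ->
    (connect (adj F) x0 (orient e).1) = connect (adj F) x0 x.
  move=> eF; rewrite ends_orient !inE => /orP[] /eqP -> //.
  apply/idP/idP => /connect_trans; apply; apply: connect1.
    by apply/adjP; exists e => //; apply: ends_orient.
  by rewrite adj_sym; apply/adjP; exists e => //; apply: ends_orient.
have sC : C \subset F by apply/subsetP => e; rewrite inE => /andP[].
have walk x : connect (adj F) x0 x -> connect (adj C) x0 x.
  case/connectP => p; elim/last_ind: p x => [|p z IH] x /=;
    first by move=> _ ->.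
  rewrite rcons_path last_rcons => /andP[hp hz] ->.
  apply: connect_trans (IH _ hp erefl) _; apply: connect1.
  have [e eF ee] := adjP _ _ _ hz; apply/adjP; exists e => //.
  rewrite inE eF (connE e (last x0 p)) ?ee ?inE ?eqxx //=.
  by apply/connectP; exists p.
have covC x : x \in cover_ends C -> connect (adj F) x0 x.
  by move=> /cover_endsP[e]; rewrite inE => /andP[eF ce] /(connE e x eF) <-.
exists C; split=> //.
  have C0 : C != set0 by apply/set0Pn; exists e0; rewrite inE e0F connect0.
  rewrite /conn_edges C0 /=; apply/andP; split.
    by apply/set0Pn; exists x0; apply/cover_endsP; exists e0;
      rewrite ?inE ?e0F ?connect0 // ends_orient !inE eqxx.
  apply/forall_inP => x /covC/walk hx; apply/forall_inP => y /covC/walk hy.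
  by apply: connect_trans hy; rewrite connect_adj_sym.
rewrite -[in LHS](setID F C) (setIidPr sC) /rk spnU dimv_disjoint_sum //.
apply/eqP; rewrite -subv0; apply/subvP => v /memv_capP[vC vF].
rewrite (_ : v = 0) ?mem0v //; apply: cap_spn_supp vC vF => x.
have [cx|ncx] := boolP (connect (adj F) x0 x); [right|left] => e.
  rewrite !inE => /andP[+ eF]; rewrite eF /=; apply: contraNN => xe.
  by rewrite (connE e x).
rewrite inE => /andP[eF ce]; apply: contraNN ncx => xe.
by rewrite -(connE e x).
Qed.

(** An additive bound by the rank may be checked on connected sets. *)
Lemma le_rk_of_conn (R : numDomainType) (w : E -> R) F :
    (forall C, C \subset F -> conn_edges C ->
      \sum_(e in C) w e <= (rk inc C)%:R) ->
  \sum_(e in F) w e <= (rk inc F)%:R.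
Proof.
move: {2}#|F| (leqnn #|F|) => n; elim: n F => [|n IH] F.
  by rewrite leqn0 cards_eq0 => /eqP -> _; rewrite big_set0.
move=> cF h; have [->|F0] := eqVneq F set0; first by rewrite big_set0.
have [C [sC cC ->]] := split_component F0.
rewrite (big_setID C) /= (setIidPr sC) natrD lerD ?(h C) //.
apply: IH => [|D sD cD]; last by apply: h => //; apply: subset_trans sD _;
  apply: subsetDl.
rewrite -ltnS; apply: leq_trans cF; rewrite -(cardsID C F) (setIidPr sC).
by rewrite -[X in (X < _)%N]add0n ltn_add2r card_gt0; case/andP: cC.
Qed.

Lemma lt_rk_of_conn (R : numDomainType) (w : E -> R) F : F != set0 ->
    (forall C, C \subset F -> conn_edges C ->
      \sum_(e in C) w e < (rk inc C)%:R) ->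
  \sum_(e in F) w e < (rk inc F)%:R.
Proof.
move=> F0 h; have [C [sC cC ->]] := split_component F0.
rewrite (big_setID C) /= (setIidPr sC) natrD ltr_leD ?(h C) //.
apply: le_rk_of_conn => D sD cD; apply/ltW/h => //.
by apply: subset_trans sD _; apply: subsetDl.
Qed.

End Blocks.

(** * Biconnected graphs and their ears *)

Section Biconnected.
Context {G : multigraph}.
Local Notation V := (vertex G).
Local Notation E := (edge G).
Implicit Types (F T C : {set E}) (W A : {set V}) (K H : subgraph G).

(** The edges with both ends in a set of vertices. *)
Definition ind_edges A : {set E} := [set e | ends e \subset A].

Lemma ind_edges_sub A : [forall e in ind_edges A, ends e \subset A].
Proof. by apply/forall_inP => e; rewrite inE. Qed.

Lemma ind_edgesD1 A z :
  [set e in ind_edges A | z \notin ends e] = ind_edges (A :\ z).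
Proof. by apply/setP => e; rewrite !inE subsetD1. Qed.

Lemma walk_ind F A x p : path (adj F) x p -> {subset x :: p <= A} ->
  connect (adj (ind_edges A)) x (last x p).
Proof.
elim: p x => [|y p IH] x /=; first by rewrite connect0.
move=> /andP[/adjP[e _ ee] hp] s; apply: (@connect_trans _ _ y); last first.
  by apply: IH => // z hz; apply: s; rewrite inE hz orbT.
apply/connect1/adjP; exists e => //.
by rewrite inE ee subUset !sub1set !s ?inE ?eqxx ?orbT.
Qed.

Lemma connected_on_grow W F A : connected_on W F -> W \subset A ->
    (forall e, e \in F -> ends e \subset W) ->
    (forall x, x \in A ->
      exists2 k, k \in W & connect (adj (ind_edges A)) x k) ->
  connected_on A (ind_edges A).
Proof.
move=> /andP[/set0Pn[k0 k0W] /forall_inP cW] sWA sF h.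
have sFA : F \subset ind_edges A.
  by apply/subsetP => e /sF s; rewrite inE (subset_trans s).
apply/andP; split; first by apply/set0Pn; exists k0; apply: (subsetP sWA).
apply/forall_inP => x /h[k kW xk]; apply/forall_inP => y /h[l lW yl].
apply: connect_trans xk _; rewrite connect_adj_sym; apply: connect_trans yl _.
by apply: connectS sFA _; have /forall_inP := cW l lW; apply.
Qed.

Lemma block_conn K : block K ->
  verts K = cover_ends (edges K) /\ conn_edges (edges K).
Proof.
move=> [[cK _] nK _]; have K0 : edges K != set0 by rewrite -card_gt0.
by split; [apply: connected_cover | apply: conn_edges_sub].
Qed.

(** A block has no ear: its distinct vertices are not connected outside of it,
since otherwise the graph induced by the block and a simple path between two
of its vertices would be biconnected. *)
Lemma block_no_ear K u v : block K -> u \in verts K -> v \in verts K ->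
  connect (adj (~: edges K)) u v -> u = v.
Proof.
move=> [[cK bK] _ maxK] uK vK /connectP[p0 /shortenP[p hp up _] ev].
apply/eqP/negP => /negP nuv.
(* All the edges between vertices of [W] are added, not only those of the
   path: biconnectedness is preserved by additional edges. *)
pose W := verts K :|: [set z in u :: p].
have sK e : e \in edges K -> ends e \subset verts K by apply: ends_subset.
have sW : verts K \subset W by apply: subsetUl.
have split x : x \in u :: p -> exists p1 p2,
    [/\ p = p1 ++ p2, x = last u p1, path (adj (~: edges K)) u p1 &
        path (adj (~: edges K)) x p2].
  move=> xp; case: (splitPl xp) hp => p1 p2 e1;
    rewrite cat_path e1 => /andP[h1 h2].
  by exists p1, p2.
have bK' : biconnected (Subgraph (ind_edges_sub W)).
  split=> [|z zW] /=.
    apply: (connected_on_grow cK) => // x; rewrite inE => /orP[xK|].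
      by exists x => //; rewrite connect0.
    rewrite inE => /split[p1 [p2 [ep -> hp1 _]]]; exists u => //.
    rewrite connect_adj_sym; apply: walk_ind hp1 _ => y hy.
    by rewrite in_setU in_set ep -cat_cons mem_cat hy orbT.
  rewrite ind_edgesD1.
  have [WK [F [cWK sWK sF hWK]]] : exists WK F, [/\ connected_on WK F,
      WK \subset W :\ z, (forall e, e \in F -> ends e \subset WK) &
      forall k, k \in verts K -> k != z -> k \in WK].
    have [zK|zK] := boolP (z \in verts K).
      exists (verts K :\ z), [set e in edges K | z \notin ends e]; split=> //.
      - exact: bK.
      - exact: setSD.
      - by move=> e; rewrite inE subsetD1 => /andP[/sK -> ->].
      - by move=> k kK kz; rewrite !inE kz.
    exists (verts K), (edges K); split=> //.
    by rewrite subsetD1 sW.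
  apply: (connected_on_grow cWK) => // x; rewrite !inE => /andP[xz /orP[xK|]].
    by exists x; [apply: hWK | rewrite connect0].
  move=> xp; have := split x; rewrite inE => /(_ xp)[p1 [p2 [ep ex hp1 hp2]]].
  have memW y : y \in u :: p -> y != z -> y \in W :\ z.
    by move=> yp yz; rewrite !inE yz -in_cons yp orbT.
  (* The path being simple, [z] is missing from the part of the path before
     [x] or from the part after it. *)
  have [zp1|zp1] := boolP (z \in u :: p1).
    have zp2 : z \notin x :: p2.
      rewrite inE eq_sym negb_or xz /=; apply/negP => zp2.
      by move: up; rewrite ep -cat_cons cat_uniq => /and3P[_ /hasP[]]; exists z.
    have vp2 : v = last x p2 by rewrite ev ep last_cat ex.
    exists v.
      apply: hWK => //; apply: contraNneq zp2 => <-.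
      by rewrite vp2 mem_last.
    rewrite vp2; apply: walk_ind hp2 _ => y yp2; apply: memW.
      move: yp2; rewrite ep -cat_cons mem_cat inE => /orP[/eqP ->|->];
        last by rewrite orbT.
      by rewrite ex mem_last.
    by apply: contraNneq zp2 => <-.
  exists u; first by apply: hWK => //; apply: contraNneq zp1 => <-;
    rewrite mem_head.
  rewrite connect_adj_sym ex; apply: walk_ind hp1 _ => y yp1; apply: memW.
    by rewrite ep -cat_cons mem_cat yp1.
  by apply: contraNneq zp1 => <-.
have sE : edges K \subset ind_edges W.
  by apply/subsetP => e /sK s; rewrite inE (subset_trans s).
have eK := maxK _ bK' sW sE.
case: p hp ev @W sW split bK' sE eK {up} => [|y p] /=; first by move=> _ ev;
  rewrite ev eqxx in nuv.
move=> /andP[/adjP[e]];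
  rewrite inE => eNK ee _ _ _ _ _ _ /(congr1 (@edges G)) /= eW.
case/negP: eNK; rewrite -eW inE ee subUset !sub1set !inE uK.
by rewrite !eqxx !orbT.
Qed.

(** A block is a direct summand. *)
Lemma block_direct K : block K ->
  (spn inc (edges K) :&: spn inc (~: edges K) = 0)%VS.
Proof.
move=> bK; apply/eqP; rewrite -subv0; apply/subvP => v /memv_capP[vK vN].
suff -> : v = 0 by rewrite mem0v.
have out y : y \notin verts K -> v y = 0.
  move=> yK; apply: spn_supp vK => e /ends_subset/subsetP s.
  by apply: contraNN yK => /s.
apply/ffunP => x; rewrite [RHS]ffunE;
  have [xK|/out //] := boolP (x \in verts K).
(* A component of the complement meets the block in one vertex at most. *)
have : \sum_(y in [set y | connect (adj (~: edges K)) x y]) v y = 0.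
  apply: (spn_sum0 _ vN) => e a c eF ee; rewrite !inE.
  apply/idP/idP => /connect_trans; apply; apply: connect1; last rewrite adj_sym;
    by apply/adjP; exists e.
rewrite (bigD1 x) ?inE ?connect0 //= big1 ?addr0 // => y;
  rewrite inE => /andP[xy nyx].
apply: out; apply: contraNN nyx => yK; apply/eqP/esym.
exact: block_no_ear xy.
Qed.

(** Following a walk to a vertex covered by [C] until the first such vertex
only uses edges outside of [C]. *)
Lemma walk_hit F C w t : connect (adj F) w t -> t \in cover_ends C ->
  exists u, [/\ u \in cover_ends C, connect (adj (F :\: C)) w u &
    (u == w) || (u \in cover_ends F)].
Proof.
case/connectP => p; elim: p w => [|y p IH] w /=.
  by move=> _ -> tC; exists w; rewrite connect0 eqxx.
move=> /andP[/adjP[e eF ee] hp] et tC.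
have [wC|wC] := boolP (w \in cover_ends C); first by exists w;
  rewrite connect0 eqxx.
have [u [uC yu hu]] := IH y hp et tC; exists u; split=> //.
  apply: connect_trans yu; apply: connect1; apply/adjP; exists e => //.
  rewrite inE eF andbT; apply: contraNN wC => eC.
  by apply/cover_endsP; exists e; rewrite // ee !inE eqxx.
case/orP: hu => [/eqP ->|->]; last by rewrite orbT.
by apply/orP; right; apply/cover_endsP; exists e; rewrite // ee !inE eqxx orbT.
Qed.

(** In a biconnected graph, a connected proper edge set has an ear. *)
Lemma biconnected_ear K C :
  biconnected K -> C \proper edges K -> conn_edges C ->
  exists u v, [/\ u != v, u \in cover_ends C, v \in cover_ends C &
    connect (adj (edges K :\: C)) u v].
Proof.
move=> [cK bK] /properP[sCK [e eK eC]] /andP[/set0Pn[e1 e1C] cC].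
apply: contrapT => hN.
have H u v : u \in cover_ends C -> v \in cover_ends C ->
    connect (adj (edges K :\: C)) u v -> u = v.
  move=> uC vC uv; apply/eqP/negP => /negP nuv; apply: hN.
  by exists u, v.
have sCV : cover_ends C \subset verts K.
  by apply/bigcupsP => e' e'C; apply: ends_subset; apply: (subsetP sCK).
have e1cov z : z \in ends e1 -> z \in cover_ends C.
  by move=> ze; apply/cover_endsP; exists e1.
(* A vertex [w] outside of [C] reaches [C] at some [u] and, avoiding [u], at
   another vertex; these two would be connected outside of [C]. *)
have claim w : w \in verts K -> w \in cover_ends C.
  move=> wK; apply: contrapT => /negP wC.
  have tC : (orient e1).1 \in cover_ends C by apply: e1cov;
    rewrite ends_orient !inE eqxx.
  have /andP[_ /forall_inP/(_ w wK)/forall_inP/(_ _ (subsetP sCV _ tC)) cwt] :=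
    cK.
  have [u [uC wu _]] := walk_hit cwt tC.
  have [t' t'C nt'u] : exists2 t', t' \in cover_ends C & t' != u.
    have [eu|nu] := eqVneq (orient e1).1 u; last by exists (orient e1).1.
    exists (orient e1).2; first by apply: e1cov;
      rewrite ends_orient !inE eqxx orbT.
    by rewrite -eu eq_sym orient_neq.
  have uK := subsetP sCV _ uC.
  have wu' : w != u by apply: contraNneq wC => ->.
  have /andP[_ /forall_inP/(_ w)] := bK u uK.
  rewrite !inE wu' wK => /(_ isT)/forall_inP/(_ t').
  rewrite !inE nt'u (subsetP sCV _ t'C) => /(_ isT) cwt'.
  have [u' [u'C wu2 hu']] := walk_hit cwt' t'C.
  have nu'u : u' != u.
    case/orP: hu' => [/eqP -> //|/cover_endsP[e2]];
      rewrite inE => /andP[_ h] h'.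
    by apply: contraNneq h => <-.
  case/eqP: nu'u; apply: H => //.
  apply: connect_trans wu; rewrite connect_adj_sym; apply: connectS wu2.
  by apply: setSD; apply/subsetP => e2; rewrite inE => /andP[].
have /subsetP sE := ends_subset eK.
case/eqP: (orient_neq e); apply: H.
- by apply/claim/sE; rewrite ends_orient !inE eqxx.
- by apply/claim/sE; rewrite ends_orient !inE eqxx orbT.
- apply: connect1; apply/adjP; exists e; last exact: ends_orient.
  by rewrite inE eC.
Qed.

Lemma biconnected_not_direct K C : biconnected K -> C \proper edges K ->
  conn_edges C -> (spn inc C :&: spn inc (~: C) != 0)%VS.
Proof.
move=> bK pC cC; have [u [v [nuv uC vC cuv]]] := biconnected_ear bK pC cC.
have h1 : dl u - dl v \in spn inc C.
  apply: connect_spn;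
    have /andP[_ /andP[_ /forall_inP/(_ u uC)/forall_inP]] := cC; exact.
have h2 : dl u - dl v \in spn inc (~: C).
  by apply: connect_spn; apply: connectS cuv; rewrite setDE subsetIr.
apply/eqP => h0; have : dl u - dl v \in (spn inc C :&: spn inc (~: C))%VS.
  by rewrite memv_cap h1.
rewrite h0 memv0 => /eqP/ffunP/(_ u); rewrite !ffunE eqxx (negPf nuv).
by rewrite subr0 => /eqP; rewrite oner_eq0.
Qed.

Lemma biconnected_edge (e : E) : biconnected (induced [set e]).
Proof.
have ce : cover_ends [set e] = ends e by rewrite /cover_ends big_set1.
have xye := ends_orient e; have nxy := orient_neq e.
move: xye nxy; case: (orient e) => x y /= xye nxy.
split=> [|z]; rewrite /connected_sub /connected_on /= ce.
  apply/andP; split; first by apply/set0Pn; exists x; rewrite xye !inE eqxx.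
  have cxy : connect (adj [set e]) x y.
    by apply/connect1/adjP; exists e; rewrite ?inE.
  apply/forall_inP => a; rewrite xye !inE => ha; apply/forall_inP => b.
  rewrite !inE => hb; case/orP: ha => /eqP ->; case/orP: hb => /eqP ->;
    by rewrite ?connect0 // connect_adj_sym.
move=> ze; have [t et tz] := in_ends (in_setT e) ze.
have -> : ends e :\ z = [set t].
  by apply/setP => a; rewrite et !inE; case: eqVneq => [->|];
    rewrite // eq_sym (negPf tz).
apply/andP; split; first by apply/set0Pn; exists t; rewrite inE.
apply/forall_inP => a /set1P ->; apply/forall_inP => b /set1P ->.
exact: connect0.
Qed.

(** Every edge lies in a block. *)
Lemma edge_in_block (e : E) : exists2 K, block K & e \in edges K.
Proof.
pose P n := `[< exists K : subgraph G, [/\ biconnected K, e \in edges K &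
  (#|verts K| + #|edges K| = n)%N] >].
have exP : exists n, P n.
  exists (#|verts (induced [set e])| + #|edges (induced [set e])|)%N.
  by apply/asboolP; exists (induced [set e]); split; rewrite ?inE //;
    apply: biconnected_edge.
have ubP n : P n -> (n <= #|V| + #|E|)%N.
  by move=> /asboolP[K [_ _ <-]]; rewrite leq_add ?max_card.
(* A biconnected subgraph containing [e] of maximal size is a block. *)
case: (ex_maxnP exP ubP) => n /asboolP[K [bK eK cK]] maxn.
exists K => //; split=> //; first by rewrite card_gt0; apply/set0Pn; exists e.
move=> K' bK' sv se.
have : (#|verts K'| + #|edges K'| <= n)%N.
  by apply: maxn; apply/asboolP; exists K'; split=> //; apply: (subsetP se).
rewrite -cK => h; have h1 := subset_leq_card sv; have h2 := subset_leq_card se.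
apply: subgraph_eq; apply/eqP; rewrite eq_sym eqEcard ?sv ?se /=; lia.
Qed.

End Biconnected.

(** * Minimisation over a box *)

Lemma box_min (R : realType) (E : finType) (M : R) (g : (E -> R) -> R) :
    0 <= M ->
    continuous (fun v : 'rV[R]_#|E| => g (fun e => v 0 (enum_rank e))) ->
  exists2 s0 : E -> R, (forall e, `|s0 e| <= M) &
    forall s : E -> R, (forall e, `|s e| <= M) -> g s0 <= g s.
Proof.
move=> M0 cg.
pose A := [set v : 'rV[R]_#|E| | forall i, v ord0 i \in `[- M, M]%R]%classic.
have cA : compact A.
  apply: (@rV_compact _ _ (fun=> `[- M, M]%classic)) => _.
  exact: segment_compact.
have A0 : (A !=set0)%classic.
  by exists 0 => i; rewrite mxE in_itv /= oppr_le0 M0.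
have [v vA vmin] := EVT_min_rV A0 cA (continuous_subspaceT cg).
exists (fun e => v 0 (enum_rank e)) => [e|s hs].
  by move/set_mem: vA => /(_ (enum_rank e)); rewrite in_itv /= ler_norml.
have := vmin (\row_i s (enum_val i)).
have -> : (fun e => (\row_i s (enum_val i)) 0 (enum_rank e)) = s.
  by apply/funext => e; rewrite mxE enum_rankK.
by apply; apply/mem_set => i; rewrite mxE in_itv /= -ler_norml.
Qed.

Lemma continuous_sum_fun (R : realType) (T : topologicalType) (I : finType)
    (P : pred I) (f : I -> T -> R) :
  (forall i, continuous (f i)) -> continuous (fun x => \sum_(i | P i) f i x).
Proof.
move=> cf; apply: continuous_big => [|i _]; last exact: cf.
exact: add_continuous.
Qed.

(** * Density and the spanning tree optimisation *)

Section Density.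
Context {R : realType} {G : multigraph} (beta : edge G -> R).
Hypotheses (connG : connected_sub (whole G)) (pmf_beta : positive_pmf beta).
Local Notation V := (vertex G).
Local Notation E := (edge G).
Local Notation trees := (spanning_trees G).
Local Notation rkE F := ((rk inc F)%:R : R).
Implicit Types (F T C : {set E}) (K H : subgraph G) (s : E -> R).

(** The weights rescaled to have the total mass of a spanning tree. *)
Definition wt e : R := rkE [set: E] * beta e.

Lemma wt_sum F : \sum_(e in F) wt e = rkE [set: E] * \sum_(e in F) beta e.
Proof. by rewrite mulr_sumr. Qed.

Lemma wt_total : \sum_e wt e = rkE [set: E].
Proof. by have [_ b1] := pmf_beta; rewrite -mulr_sumr b1 mulr1. Qed.

Lemma wt_total_set : \sum_(e in [set: E]) wt e = rkE [set: E].
Proof. by rewrite -wt_total; apply: eq_bigl => e; rewrite inE. Qed.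

Lemma edge_exists : exists e0 : E, True.
Proof.
have [_ b1] := pmf_beta; apply: contrapT => h.
move: b1; rewrite big1 => [/esym/eqP|e]; first by rewrite oner_eq0.
by case: h; exists e.
Qed.

Lemma rk_gt0 F : F != set0 -> (0 < rk inc F)%N.
Proof.
move=> /set0Pn[e eF]; apply: (@leq_trans (rk (@inc G) [set e])); last first.
  by apply: rkS; rewrite sub1set.
rewrite lt0n /rk dimv_eq0 spn1; apply/eqP => h.
have : inc e \in <[inc e]>%VS := memv_line _.
rewrite h memv0 => /eqP/ffunP/(_ (orient e).1); rewrite /inc !ffunE eqxx.
by rewrite (negPf (orient_neq e)) subr0 => /eqP; rewrite oner_eq0.
Qed.

Lemma rho_gt0 : 0 < rkE [set: E].
Proof.
have [e0 _] := edge_exists; rewrite ltr0n rk_gt0 //.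
by apply/set0Pn; exists e0.
Qed.

Lemma theta_conn H : verts H = cover_ends (edges H) -> conn_edges (edges H) ->
  theta beta H = (\sum_(e in edges H) beta e) / rkE (edges H).
Proof.
by move=> vH /rk_conn_edges cH; rewrite /theta vH -cH -natr1 addrK.
Qed.

Lemma theta_whole : theta beta (whole G) = (rkE [set: E])^-1.
Proof.
rewrite /theta /= cardsT -(rk_whole connG) -natr1 addrK.
have [_ b1] := pmf_beta.
rewrite (_ : \sum_(e in [set: E]) beta e = 1) ?mul1r // -[RHS]b1.
by apply: eq_bigl => e; rewrite inE.
Qed.

Lemma theta_le_wt H : verts H = cover_ends (edges H) -> conn_edges (edges H) ->
  (theta beta H <= theta beta (whole G)) =
  (\sum_(e in edges H) wt e <= rkE (edges H)).
Proof.
move=> vH cH; have r0 : 0 < rkE (edges H).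
  by rewrite ltr0n rk_gt0 //; case/andP: cH.
rewrite theta_conn // theta_whole ler_pdivrMr // wt_sum.
by rewrite -(ler_pM2l rho_gt0) mulrA divff ?mul1r // gt_eqF // rho_gt0.
Qed.

Lemma theta_lt_wt H : verts H = cover_ends (edges H) -> conn_edges (edges H) ->
  (theta beta H < (rkE [set: E])^-1) =
  (\sum_(e in edges H) wt e < rkE (edges H)).
Proof.
move=> vH cH; have r0 : 0 < rkE (edges H).
  by rewrite ltr0n rk_gt0 //; case/andP: cH.
rewrite theta_conn // ltr_pdivrMr // wt_sum.
by rewrite -(ltr_pM2l rho_gt0) mulrA divff ?mul1r // gt_eqF // rho_gt0.
Qed.

(** Density in terms of ranks: the rescaled weights satisfy the inequalities
of the base polytope of the graphic matroid. *)
Definition rk_dense := forall F, \sum_(e in F) wt e <= rkE F.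

Lemma beta_denseP : beta_dense beta (whole G) <-> rk_dense.
Proof.
split=> [bd F|d H /conn_subgraphsP[_ vH cH]]; last by rewrite theta_le_wt.
apply: le_rk_of_conn => C _ cC; rewrite -(@theta_le_wt (induced C)) //.
by apply/bd/conn_subgraphs_induced => //; apply: subsetT.
Qed.

(** The logarithm of the weight of a tree for [expR \o s], minus the
[wt]-average of [s]. *)
Definition excess s T : R := \sum_(e in T) s e - \sum_e wt e * s e.

(** The weighted number of spanning trees in logarithmic coordinates,
normalised so as to be invariant under the addition of constants to [s]. *)
Definition tsum s : R := \sum_(T in trees) expR (excess s T).

Lemma excessD s u T : excess (fun e => s e + u e) T = excess s T + excess u T.
Proof.
rewrite /excess big_split /=; under [\sum_e wt e * _]eq_bigr do rewrite mulrDr.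
by rewrite big_split /=; ring.
Qed.

Lemma excess_set F c T :
  excess (fun e => c * (e \in F)%:R) T =
  c * (#|T :&: F|%:R - \sum_(e in F) wt e).
Proof.
rewrite /excess mulrBr -sum1_card natr_sum !mulr_sumr; congr (_ - _).
  rewrite (big_setID F) /= [X in _ + X]big1 ?addr0 => [|e].
    by apply: eq_bigr => e /setIP[_ ->].
  by rewrite inE => /andP[/negPf -> _]; rewrite mulr0.
rewrite [RHS]big_mkcond; apply: eq_bigr => e _.
by case: ifP; rewrite ?mulr0 // mulr1 mulrC.
Qed.

Lemma excess_cst c T : T \in trees -> excess (fun=> c) T = 0.
Proof.
move=> /(spanning_treesP connG)[/eqP iT eT].
rewrite /excess sumr_const -iT /rk eT -/(rk _ _) -mulr_suml wt_total mulr_natl.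
by rewrite subrr.
Qed.

Lemma tree_sum_exp s : \sum_e beta e * s e = 0 ->
  tree_sum (fun e => expR (s e)) = tsum s.
Proof.
move=> h; apply: eq_bigr => T _; rewrite -expR_sum /excess.
have -> : \sum_e wt e * s e = rkE [set: E] * \sum_e beta e * s e.
  by rewrite mulr_sumr; apply: eq_bigr => e _; rewrite mulrA.
by rewrite h mulr0 subr0.
Qed.

Lemma feasible_exp s : \sum_e beta e * s e = 0 ->
  feasible beta (fun e => expR (s e)).
Proof.
move=> h; split=> [e|]; first exact: expR_gt0.
under eq_bigr do rewrite -expRM mulrC.
by rewrite -expR_sum h expR0.
Qed.

Lemma feasibleP sigma : feasible beta sigma ->
  exists2 s, \sum_e beta e * s e = 0 & sigma = (fun e => expR (s e)).
Proof.
move=> [s0 s1];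
  have es e : expR (ln (sigma e)) = sigma e by rewrite lnK // posrE.
exists (fun e => ln (sigma e)); last by apply/funext => e; rewrite es.
apply: expR_inj; rewrite expR0 -s1 expR_sum; apply: eq_bigr => e _.
by rewrite mulrC expRM es.
Qed.

(** Translating along constants makes any point feasible. *)
Lemma tsum_feasible s :
  exists2 sigma, feasible beta sigma & tree_sum sigma = tsum s.
Proof.
pose c := - \sum_e beta e * s e; have [_ b1] := pmf_beta.
have h : \sum_e beta e * (s e + c) = 0.
  under eq_bigr do rewrite mulrDr.
  by rewrite big_split /= -mulr_suml b1 mul1r subrr.
exists (fun e => expR (s e + c)); first exact: feasible_exp.
rewrite tree_sum_exp //; apply: eq_bigr => T hT.
by rewrite (excessD s (fun=> c)) excess_cst // addr0.
Qed.

Lemma feasible_tsum sigma : feasible beta sigma ->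
  exists s, tree_sum sigma = tsum s.
Proof. by move=> /feasibleP[s h ->]; exists s; apply: tree_sum_exp. Qed.

Lemma tsum_gt0 s : 0 < tsum s.
Proof.
have [T hT _] := tree_extend connG (indep0 (@inc G)).
rewrite /tsum (bigD1 T) //= ltr_pwDl ?expR_gt0 // sumr_ge0 // => U _;
  apply: expR_ge0.
Qed.

Lemma excess_le_tsum s T : T \in trees -> expR (excess s T) <= tsum s.
Proof.
move=> hT; rewrite /tsum (bigD1 T) //= lerDl sumr_ge0 // => U _;
  apply: expR_ge0.
Qed.

(** Under density the greedy spanning tree has nonnegative excess. *)
Lemma dense_tsum_ge1 s : rk_dense -> 1 <= tsum s.
Proof.
move=> d; have [e0 _] := edge_exists.
have [|T [iT eT hT]] := @greedy_basis _ _ _ inc R s wt e0 e0 0 (lexx 0) d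
  wt_total.
  by move=> F ->.
have hTt : T \in trees by apply/(spanning_treesP connG).
apply: le_trans (excess_le_tsum s hTt); rewrite -expR0 ler_expR.
by rewrite mul0r in hT.
Qed.

(** Along the direction of a set violating density the sum tends to zero. *)
Lemma not_dense_small eps : ~ rk_dense -> 0 < eps -> exists s, tsum s < eps.
Proof.
move=> /existsNP[F /negP]; rewrite -ltNge => hF e0.
pose eta := \sum_(e in F) wt e - rkE F; pose N : R := #|trees|%:R.
have eta0 : 0 < eta by rewrite subr_gt0.
(* Chosen so that [N * expR (- (t * eta)) < eps], using [1 + x <= expR x]. *)
pose t := N / (eps * eta).
have N0 : 0 <= N by rewrite ler0n.
have t0 : 0 <= t by rewrite divr_ge0 // mulr_ge0 // ltW.
exists (fun e => t * (e \in F)%:R).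
apply: (@le_lt_trans _ _ (N * expR (- (t * eta)))).
  rewrite /N -sum1_card natr_sum mulr_suml; apply: ler_sum => T hT.
  rewrite mul1r ler_expR excess_set -mulrN ler_wpM2l // opprB lerD2r ler_nat.
  exact: tree_meet_leq.
rewrite expRN -/(_ / _) ltr_pdivrMr ?expR_gt0 //.
have te : t * eta = N / eps by rewrite /t; field; rewrite !gt_eqF.
have := expR_ge1Dx (t * eta); rewrite -(ler_pM2l e0) {1}te mulrDr mulr1.
by rewrite mulrCA divff ?gt_eqF // mulr1 => h; apply: lt_le_trans h; lra.
Qed.

Lemma inf_gt0_dense :
  0 < inf [set tree_sum sigma | sigma in feasible beta]%classic <-> rk_dense.
Proof.
split=> [i0|d].
  apply: contrapT => /not_dense_small/(_ i0)[s hs].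
  have [sigma fs es] := tsum_feasible s.
  move: hs; rewrite -es ltNge => /negP; apply.
  apply: ge_inf; last by exists sigma.
  by exists 0 => _ [tau /feasible_tsum[u ->] <-]; apply/ltW/tsum_gt0.
apply: lt_le_trans ltr01 _; apply: lb_le_inf.
  by have [sigma fs _] := tsum_feasible (fun=> 0);
    exists (tree_sum sigma), sigma.
by move=> _ [tau /feasible_tsum[u ->] <-]; apply: dense_tsum_ge1.
Qed.

(** * Minimisers *)

Lemma tree_meet_direct F T : (spn inc F :&: spn inc (~: F) = 0)%VS ->
  T \in trees -> #|T :&: F| = rk inc F.
Proof.
move=> dF hT; have := tree_meet_leq connG F hT.
have := tree_meet_leq connG (~: F) hT.
have := rk_split [set: E] dF; rewrite setTI setTD.
have [/eqP iT eT] := (spanning_treesP connG T).1 hT.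
by rewrite /(rk _ [set: E]) -eT -/(rk _ T) iT -(cardsID F T) setDE; lia.
Qed.

(** A direct summand is tight for rank-dense weights. *)
Lemma direct_tight F : rk_dense -> (spn inc F :&: spn inc (~: F) = 0)%VS ->
  \sum_(e in F) wt e = rkE F.
Proof.
move=> d dF; have h1 := d F; have h2 := d (~: F).
have := rk_split [set: E] dF; rewrite setTI setTD.
move=> /(congr1 (fun n => n%:R : R)); rewrite natrD -wt_total_set.
rewrite (big_setID F) /= setTI setTD => h.
by apply/eqP; rewrite eq_le h1 /=; lra.
Qed.

Lemma theta_block K : rk_dense -> block K ->
  theta beta K = (rkE [set: E])^-1.
Proof.
move=> d bK; have [vK cK] := block_conn bK.
have tK := direct_tight d (block_direct bK).
have rK0 : 0 < rkE (edges K) by rewrite ltr0n rk_gt0 //; case/andP: cK.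
rewrite theta_conn // -tK wt_sum invfM mulrCA divff ?mulr1 // gt_eqF //.
by rewrite -(pmulr_rgt0 _ rho_gt0) -wt_sum tK.
Qed.

(** At a minimiser, a set [F] whose weight is at least its rank meets all
spanning trees in [rk F] edges: increasing [s] on [F] does not increase any term
of the sum, and would decrease the term of a tree with fewer edges in [F]. *)
Lemma minimiser_tight s F : (forall u, tsum s <= tsum u) ->
    rkE F <= \sum_(e in F) wt e ->
  forall T, T \in trees -> #|T :&: F| = rk inc F.
Proof.
move=> smin hF T hT; apply/eqP; rewrite eqn_leq tree_meet_leq //=.
rewrite leqNgt; apply/negP => lt.
have := smin (fun e => s e + 1 * (e \in F)%:R); rewrite leNgt => /negP; apply.
have le U : U \in trees -> #|U :&: F|%:R <= \sum_(e in F) wt e.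
  by move=> hU; apply: le_trans hF; rewrite ler_nat tree_meet_leq.
rewrite /tsum (bigD1 T) //= [X in _ < X](bigD1 T) //=; apply: ltr_leD.
  rewrite ltr_expR excessD excess_set mul1r gtrDl subr_lt0.
  by apply: lt_le_trans hF; rewrite ltr_nat.
apply: ler_sum => U /andP[hU _].
by rewrite ler_expR excessD excess_set mul1r gerDl subr_le0 le.
Qed.

Lemma minimiser_dense s : (forall u, tsum s <= tsum u) -> rk_dense.
Proof.
move=> smin; apply: contrapT => /not_dense_small/(_ (tsum_gt0 s))[u].
by rewrite ltNge smin.
Qed.

Lemma minimiser_block s K : (forall u, tsum s <= tsum u) -> block K ->
  strictly_beta_dense beta K.
Proof.
move=> smin bK H hH nHK.
have d := minimiser_dense smin.
have [sHK vH cH] := conn_subgraphsP hH; have [vK _] := block_conn bK.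
have pH : edges H \proper edges K.
  rewrite properEneq sHK andbT; apply/eqP => eHK; apply: nHK.
  by apply: subgraph_eq => //; rewrite vH vK eHK.
rewrite (theta_block d bK) theta_lt_wt // ltNge; apply/negP => hw.
have [biK _ _] := bK; have /eqP := biconnected_not_direct biK pH cH; apply.
apply: bases_split => J iJ eJ.
by apply: (minimiser_tight smin hw); apply/(spanning_treesP connG).
Qed.

Section StrictBlocks.
Hypothesis d : rk_dense.
Hypothesis sb : forall K : subgraph G, block K -> strictly_beta_dense beta K.

Lemma block_strict K F : block K -> F \subset edges K -> F != set0 ->
  F != edges K -> \sum_(e in F) wt e < rkE F.
Proof.
move=> bK sF F0 nF; apply: lt_rk_of_conn => // C sC cC.
have sCK : C \subset edges K := subset_trans sC sF.
rewrite -(@theta_lt_wt (induced C)) // -(theta_block d bK).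
apply: (sb bK (conn_subgraphs_induced sCK cC)) => eCK.
by case/eqP: nF; apply/eqP; rewrite eqEsubset sF -eCK.
Qed.

(** A set cutting a block has positive slack. *)
Lemma block_cut_strict K F e1 e2 :
  block K -> e1 \in edges K -> e2 \in edges K ->
  e1 \in F -> e2 \notin F -> \sum_(e in F) wt e < rkE F.
Proof.
move=> bK e1K e2K e1F e2F.
rewrite (rk_split F (block_direct bK)) (big_setID (edges K)) /= natrD.
apply: ltr_leD; last exact: d.
apply: (block_strict bK); first exact: subsetIr.
  by apply/set0Pn; exists e1; rewrite inE e1F.
by apply/eqP => /setP/(_ e2); rewrite inE e2K (negPf e2F).
Qed.

Lemma block_disjoint K K' e : block K -> block K' -> e \in edges K ->
  e \in edges K' -> edges K = edges K'.
Proof.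
move=> bK bK' eK eK'.
suff sub K1 K2 : block K1 -> block K2 -> e \in edges K1 -> e \in edges K2 ->
    edges K1 \subset edges K2 by apply/eqP; rewrite eqEsubset !sub.
move=> b1 b2 h1 h2; apply/subsetP => f f1; apply: contrapT => /negP f2.
have := block_cut_strict b1 h1 f1 h2 f2.
by rewrite (direct_tight d (block_direct b2)) ltxx.
Qed.

(** The edge set of a chosen block containing an edge; under the present
hypotheses there is only one such block. *)
Definition block_of (e : E) : {set E} :=
  edges (projT1 (cid2 (edge_in_block e))).

Lemma block_ofP e :
  exists K, [/\ block K, e \in edges K & block_of e = edges K].
Proof. by rewrite /block_of; case: cid2 => K bK eK; exists K. Qed.

Lemma block_of_eq e f : (f \in block_of e) = (block_of f == block_of e).
Proof.
have [K [bK eK ->]] := block_ofP e; have [K' [bK' fK' ->]] := block_ofP f.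
apply/idP/eqP => [fK|<- //]; exact: block_disjoint bK' bK fK' fK.
Qed.

(** Adding a constant on each block does not change the excess. *)
Lemma excess_blocks (c : {set E} -> R) T : T \in trees ->
  excess (fun e => c (block_of e)) T = 0.
Proof.
move=> hT; rewrite /excess; apply/eqP; rewrite subr_eq0; apply/eqP.
rewrite (partition_big block_of xpredT) //= [RHS](partition_big block_of
  xpredT) //=.
apply: eq_bigr => X _.
have [[e0 e0X]|nX] := pselect (exists e0, block_of e0 = X); last first.
  by rewrite !big_pred0 // => e; apply/negP => h;
    apply: nX; exists e; apply/eqP; move: h => // /andP[].
have eqX e : (block_of e == X) = (e \in X) by rewrite -e0X -block_of_eq.
transitivity (#|T :&: X|%:R * c X).
  rewrite -sum1_card natr_sum mulr_suml;
    apply: eq_big => [e|e /andP[_ /eqP ->]].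
    by rewrite eqX inE.
  by rewrite mul1r.
transitivity ((\sum_(e in X) wt e) * c X); last first.
  rewrite mulr_suml; apply: eq_big => [e|e eX]; first by rewrite eqX.
  by move: eX; rewrite -eqX => /eqP ->.
have [K [bK _ eK]] := block_ofP e0; rewrite -e0X eK.
by rewrite (tree_meet_direct (block_direct bK) hT) (direct_tight d
  (block_direct bK)).
Qed.

(** There being finitely many edge sets, positive slacks are bounded below. *)
Lemma slack_bound : exists2 del : R, 0 < del &
  forall F, \sum_(e in F) wt e < rkE F -> \sum_(e in F) wt e + del <= rkE F.
Proof.
pose m := \big[Num.min/1]_(F : {set E} | \sum_(e in F) wt e < rkE F)
  (rkE F - \sum_(e in F) wt e).
exists m => [|F hF].
  rewrite /m; elim/big_ind: _ => // [x y x0 y0|F hF]; last by rewrite subr_gt0.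
  by rewrite lt_min x0.
by rewrite -lerBrDl /m (bigD1 F) //= ge_min lexx.
Qed.

(** The sum controls the oscillation on every block. *)
Lemma tsum_osc : exists2 del : R, 0 < del & forall s e f,
  f \in block_of e -> del * (s e - s f) <= tsum s.
Proof.
have [del del0 hdel] := slack_bound; exists del => // s e f fe.
have [K [bK eK eB]] := block_ofP e; rewrite eB in fe.
have [|T [iT eT hT]] := @greedy_basis _ _ _ inc R s wt e f del (ltW del0) d
  wt_total.
  by move=> F eF fF; apply/hdel/(block_cut_strict bK eK fe eF fF).
have hTt : T \in trees by apply/(spanning_treesP connG).
apply: le_trans (excess_le_tsum s hTt); apply: le_trans hT _.
apply: le_trans (expR_ge1Dx _); rewrite /excess; lra.
Qed.

Lemma continuous_tsum :
  continuous (fun v : 'rV[R]_#|E| => tsum (fun e => v 0 (enum_rank e))).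
Proof.
apply: continuous_sum_fun => T v.
apply: (@continuous_comp _ _ _ (fun v : 'rV[R]_#|E| =>
  excess (fun e => v 0 (enum_rank e)) T) expR); last exact: continuous_expR.
apply: continuousB; apply: continuous_sum_fun => e u.
  exact: coord_continuous.
apply: (@continuousM R _ (fun=> wt e) (fun v : 'rV[R]_#|E| => v 0 (enum_rank
  e))).
  exact: cst_continuous.
exact: coord_continuous.
Qed.

Lemma minimiser_exists : exists s, forall u, tsum s <= tsum u.
Proof.
have [del del0 hdel] := tsum_osc.
(* The points [u] with [tsum u <= tsum (fun=> 0)] oscillate by at most [M] on
   every block. *)
pose M := tsum (fun=> 0) / del.
have M0 : 0 <= M by rewrite divr_ge0 // ltW // tsum_gt0.
have [s sM smin] := box_min M0 continuous_tsum.
have s_le0 : tsum s <= tsum (fun=> 0) by apply: smin => e; rewrite normr0.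
exists s => u; rewrite leNgt; apply/negP => lt.
(* Subtracting from [u] its value at one edge of each block moves it into the
   box. *)
pose c (X : {set E}) : R := if [pick e in X] is Some e then u e else 0.
pose u' e := u e + - c (block_of e).
have eu : tsum u' = tsum u.
  apply: eq_bigr => T hT; rewrite /u' (excessD u (fun e => - c (block_of e))).
  by rewrite (excess_blocks (fun X => - c X)) // addr0.
suff u'M e : `|u' e| <= M by have := smin u' u'M; rewrite eu leNgt lt.
have ub f : f \in block_of e -> u e - u f <= M /\ u f - u e <= M.
  move=> fe;
    have le0 : tsum u <= tsum (fun=> 0) by apply: le_trans (ltW lt) s_le0.
  split; rewrite /M ler_pdivlMr // mulrC; apply: le_trans le0;
    apply: hdel => //.
  by rewrite block_of_eq eq_sym -block_of_eq.
rewrite /u' /c; case: pickP => [f /ub[h1 h2]|/(_ e)]; last first.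
  by rewrite block_of_eq eqxx.
by rewrite ler_norml -lerNl opprB h2 h1.
Qed.

End StrictBlocks.

Lemma minimiser_iff :
  (exists2 sigma, feasible beta sigma &
     forall tau, feasible beta tau -> tree_sum sigma <= tree_sum tau) <->
  exists s, forall u, tsum s <= tsum u.
Proof.
split=> [[sigma /feasible_tsum[s es] smin]|[s smin]].
  exists s => u; have [tau ft <-] := tsum_feasible u.
  by rewrite -es; apply: smin.
have [sigma fs es] := tsum_feasible s; exists sigma => // tau.
by move=> /feasible_tsum[u ->]; rewrite es.
Qed.

Lemma minimiser_dense_blocks :
  (exists s, forall u, tsum s <= tsum u) <->
  rk_dense /\ (forall K : subgraph G, block K -> strictly_beta_dense beta K).
Proof.
split=> [[s smin]|[d sb]]; last exact: minimiser_exists.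
split=> [|K]; first exact: minimiser_dense smin.
exact: minimiser_block.
Qed.

End Density.

(** * Determinants and eigenvalues *)

(** The characteristic polynomial of a matrix with zero row and column sums is
divisible by ['X]; the value of the quotient at zero is, up to sign, the size
times a principal minor. *)
Lemma char_poly_zero_sums (R : comNzRingType) n (A : 'M[R]_(1 + n)) :
    (forall i, \sum_j A i j = 0) -> (forall j, \sum_i A i j = 0) ->
  exists2 q : {poly R}, char_poly A = 'X * q &
    q.[0] = (-1) ^+ n * n.+1%:R * \det (drsubmx A).
Proof.
move=> rowA colA.
pose b : 'M[{poly R}]_(1, n) := map_mx polyC (ursubmx A).
pose D : 'M[{poly R}]_n := map_mx polyC (drsubmx A).
pose N : 'M[{poly R}]_(1 + n) := block_mx 1%:M (- b) (const_mx 1) ('X%:M - D).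
(* Adding all columns of [char_poly_mx A] to the first one makes all the
   entries of that column equal to ['X]; dividing it by ['X] gives [N]. *)
exists (\det N).
  pose S : 'M[{poly R}]_(1 + n) := block_mx 1%:M 0 (const_mx 1) 1%:M.
  pose Q : 'M[{poly R}]_(1 + n) := block_mx 'X%:M 0 0 1%:M.
  have eNQ : char_poly_mx A *m S = N *m Q.
    rewrite /char_poly_mx -[A in map_mx _ A]submxK map_block_mx.
    rewrite [X in (X - _) *m _](@scalar_mx_block _ 1 n) opp_block_mx
      add_block_mx.
    rewrite !mulmx_block !mulmx0 !mulmx1 !mul1mx !add0r !addr0; congr block_mx.
    - apply/matrixP => i j; rewrite !mxE !ord1 eqxx mulr1n.
      have := rowA (lshift n 0);
        rewrite big_split_ord big_ord1 /= => /(congr1 polyC).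
      rewrite polyC0 polyCD rmorph_sum /= => h.
      under eq_bigr do rewrite !mxE mulr1.
      by rewrite sumrN -addrA -opprD h oppr0 addr0.
    - apply/matrixP => i j; rewrite mul_mx_scalar !mxE mulr1.
      have := rowA (rshift 1 i);
        rewrite big_split_ord big_ord1 /= => /(congr1 polyC).
      rewrite polyC0 polyCD rmorph_sum /= => h.
      under eq_bigr do rewrite !mxE mulr1.
      rewrite big_split /= sumrN (bigD1 i) //= eqxx mulr1n big1 => [|k ki].
        by rewrite addr0 !ord1 addrCA -opprD h oppr0 addr0.
      by rewrite eq_sym (negPf ki).
  have := congr1 determinant eNQ;
    rewrite !det_mulmx /S /Q det_lblock det_lblock.
  by rewrite !det1 !mulr1 det_scalar1 mulrC.
rewrite -[LHS]/(horner_eval 0 (\det N)) -det_map_mx /N map_block_mx.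
(* At zero, adding all rows to the first one leaves [n.+1, 0, ..., 0] there. *)
pose S : 'M[R]_(1 + n) := block_mx 1%:M (const_mx 1) 0 1%:M.
have -> : block_mx (map_mx (horner_eval 0) 1%:M) (map_mx (horner_eval 0) (- b))
   (map_mx (horner_eval 0) (const_mx 1)) (map_mx (horner_eval 0) ('X%:M - D)) =
   block_mx 1%:M (- ursubmx A) (const_mx 1) (- drsubmx A) :> 'M[R]_(1 + n).
  congr block_mx; apply/matrixP => i j; rewrite !mxE /horner_eval ?hornerE //.
  - by rewrite !ord1 eqxx !mulr1n hornerC.
  - by rewrite hornerMn hornerX mul0rn add0r.
rewrite -[LHS]mul1r -{1}(_ : \det S = 1);
  last by rewrite det_ublock !det1 mulr1.
rewrite -det_mulmx mulmx_block !mul1mx !mul0mx !add0r.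
rewrite (_ : - ursubmx A + _ = 0).
  rewrite det_lblock -scaleN1r detZ mulrA; congr (_ * _).
  rewrite mulrC; congr (_ * _).
  rewrite det_mx11 !mxE eqxx mulr1n; under eq_bigr do rewrite !mxE mulr1.
  by rewrite sumr_const card_ord -natr1 addrC.
apply/matrixP => i j; rewrite !mxE ord1.
have := colA (rshift 1 j); rewrite big_split_ord big_ord1 /= => h.
under eq_bigr do rewrite !mxE mul1r.
by rewrite sumrN -opprD h oppr0.
Qed.

Lemma char_poly_conj (F : fieldType) n (P A : 'M[F]_n) : P \in unitmx ->
  char_poly (invmx P *m A *m P) = char_poly A.
Proof.
move=> uP; rewrite /char_poly.
have -> : char_poly_mx (invmx P *m A *m P) =
    map_mx polyC (invmx P) *m char_poly_mx A *m map_mx polyC P.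
  rewrite /char_poly_mx mulmxBr mulmxBl !map_mxM; congr (_ - _).
  by rewrite scalar_mxC -mulmxA -map_mxM mulVmx // map_mx1 mulmx1.
rewrite !det_mulmx mulrAC -det_mulmx -map_mxM mulVmx //.
by rewrite map_mx1 det1 mul1r.
Qed.

(** The characteristic polynomial of a real symmetric matrix splits, by the
spectral theorem for Hermitian matrices. *)
Lemma char_poly_sym_split (R : rcfType) n (A : 'M[R]_n) : A^T = A ->
  exists rs : seq R, char_poly A = \prod_(a <- rs) ('X - a%:P).
Proof.
move=> sA; pose toC : {rmorphism R -> R[i]} := real_complex R.
pose B : 'M[R[i]]_n := map_mx toC A.
have hB : B \is hermsymmx.
  apply: realsym_hermsym.
    by apply/is_hermitianmxP; rewrite expr0 scale1r map_mx_id //;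
      apply/matrixP => i j; rewrite !mxE -[in LHS]sA mxE.
  by apply/mxOverP => i j; rewrite mxE; apply/complex_realP; exists (A i j).
have /orthomx_spectralP eB := hermitian_normalmx hB.
have /mxOverP rB := hermitian_spectral_diag_real hB.
pose d := spectral_diag B.
exists [seq complex.Re (d 0 i) | i <- enum 'I_n].
apply: (@map_poly_inj _ _ toC).
rewrite map_char_poly -/B eB char_poly_conj ?spectral_unit //.
rewrite char_poly_trig; last by apply: diag_mx_is_trig.
rewrite big_map map_prod_XsubC big_enum /=; apply: eq_bigr => i _.
by rewrite mxE eqxx mulr1n /toC /= RRe_real // rB.
Qed.

Lemma mup_prod_XsubC (F : fieldType) (rs : seq F) x :
  mup x (\prod_(a <- rs) ('X - a%:P)) = count_mem x rs.
Proof.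
elim: rs => [|a rs IH]; first by rewrite big_nil mupNroot // root1.
rewrite big_cons mupM ?monic_neq0 ?monicXsubC ?monic_prod_XsubC // IH /=.
by rewrite -['X - a%:P]expr1 mup_XsubCX; case: eqVneq.
Qed.

(** For a symmetric positive semidefinite matrix with zero row sums and
nonvanishing principal minor, zero is a simple eigenvalue and the product of
the other ones is the size times the minor. *)
Lemma det'_zero_sums (R : realType) n (A : 'M[R]_(1 + n)) : A^T = A ->
    (forall i, \sum_j A i j = 0) ->
    (forall v : 'rV[R]_(1 + n), 0 <= (v *m A *m v^T) 0 0) ->
    \det (drsubmx A) != 0 ->
  det' A = n.+1%:R * \det (drsubmx A).
Proof.
move=> sA rowA psdA d0.
have colA j : \sum_i A i j = 0.
  by rewrite -[RHS](rowA j); apply: eq_bigr => i _; rewrite -[in RHS]sA mxE.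
have [q eq q0] := char_poly_zero_sums rowA colA.
have [rs ers] := char_poly_sym_split sA.
have size_rs : size rs = n.+1.
  by have := size_char_poly A; rewrite ers size_prod_XsubC => -[].
have q0n : q.[0] != 0.
  by rewrite q0 !mulf_neq0 ?signr_eq0 ?pnatr_eq0.
have rs_ge0 a : a \in rs -> 0 <= a.
  move=> ars; have : eigenvalue A a.
    by rewrite eigenvalue_root_char ers root_prod_XsubC.
  case/eigenvalueP => v vA v0; have := psdA v; rewrite vA -scalemxAl mxE.
  have vv : 0 < (v *m v^T) 0 0.
    have [j vj] : exists j, v 0 j != 0 by apply/rV0Pn.
    rewrite mxE (bigD1 j) //= mxE ltr_pwDl ?sumr_ge0 // => [|i _].
      by rewrite -expr2 exprn_even_gt0.
    by rewrite mxE -expr2 sqr_ge0.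
  by rewrite pmulr_lge0.
have rs0 : 0 \in rs.
  by rewrite -root_prod_XsubC -ers eq rootM rootX eqxx.
pose rs' := rem 0 rs.
have prs : perm_eq rs (0 :: rs') by apply: perm_to_rem.
have eq' : q = \prod_(a <- rs') ('X - a%:P).
  have X0 : 'X != 0 :> {poly R} by rewrite polyX_eq0.
  apply: (mulfI X0); rewrite -eq ers (perm_big _ prs) big_cons.
  by rewrite subr0.
have size_rs' : size rs' = n by rewrite size_rem // size_rs.
have eq0 : q.[0] = (-1) ^+ n * \prod_(a <- rs') a.
  rewrite eq' horner_prod -size_rs'; elim: (rs') => [|a l IH].
    by rewrite !big_nil mulr1.
  by rewrite !big_cons IH !hornerE /= exprS; ring.
have rs'_gt0 a : a \in rs' -> 0 < a.
  move=> ars; rewrite lt_neqAle rs_ge0 ?(mem_rem ars) // andbT eq_sym.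
  apply: contra_neq q0n => a0; rewrite eq0 a0 in ars *.
  by rewrite (big_rem 0) //= mul0r mulr0.
transitivity (\prod_(a <- rs') a); last first.
  have sgn0 : (-1) ^+ n != 0 :> R by rewrite signr_eq0.
  by apply: (mulfI sgn0); rewrite -eq0 q0 mulrA.
rewrite /det' (_ : [set x | _]%classic = [set` undup rs']%classic).
  rewrite -fsbig_seq ?undup_uniq //.
  rewrite -[RHS](prodr_undup_exp_count rs' predT id); apply: eq_big_seq => x.
  rewrite mem_undup => /rs'_gt0 x0; rewrite ers mup_prod_XsubC.
  by rewrite (seq.permP prs) /= eq_sym (gt_eqF x0).
apply/seteqP; split=> x /=.
  rewrite eigenvalue_root_char ers root_prod_XsubC (perm_mem prs) inE mem_undup.
  by move=> [/orP[/eqP ->|//]]; rewrite ltxx.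
rewrite mem_undup => xrs; split; last exact: rs'_gt0.
by rewrite eigenvalue_root_char ers root_prod_XsubC (mem_rem xrs).
Qed.

(** * The matrix tree theorem *)

(** The Cauchy-Binet formula, as a sum over all functions [f] into the set of
indices instead of a sum over its subsets of [r] elements: each of these is the
image of [r`!] injective functions, and the other functions contribute zero. *)
Lemma cauchy_binet (R : comNzRingType) (E : finType) r
    (A : 'I_r -> E -> R) (B : E -> 'I_r -> R) :
  r`!%:R * \det (\matrix_(i, j) \sum_e A i e * B e j) =
  \sum_(f : {ffun 'I_r -> E}) \det (\matrix_(i, j) A i (f j)) *
    \det (\matrix_(i, j) B (f i) j).
Proof.
pose BB (f : {ffun 'I_r -> E}) := \det (\matrix_(i, j) B (f i) j).
have expand : \det (\matrix_(i, j) \sum_e A i e * B e j) =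
    \sum_(f : {ffun 'I_r -> E}) (\prod_i A i (f i)) * BB f.
  rewrite /BB /determinant; under [RHS]eq_bigr do rewrite mulr_sumr.
  rewrite exchange_big; apply: eq_bigr => s _ /=.
  under eq_bigr do rewrite mxE.
  rewrite bigA_distr_bigA mulr_sumr; apply: eq_bigr => f _.
  rewrite big_split /= mulrCA; congr (_ * (_ * _)).
  by apply: eq_bigr => i _; rewrite mxE.
have permuted (p : 'S_r) : \det (\matrix_(i, j) \sum_e A i e * B e j) =
    \sum_(f : {ffun 'I_r -> E}) ((-1) ^+ p * \prod_i A i (f (p i))) * BB f.
  pose h (f : {ffun 'I_r -> E}) := [ffun i => f (p i)].
  have bh : bijective h.
    exists (fun f : {ffun 'I_r -> E} => [ffun i => f ((p^-1)%g i)]) => f;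
      by apply/ffunP => i; rewrite !ffunE ?permK ?permKV.
  rewrite expand (reindex h) /=; last exact: onW_bij.
  apply: eq_bigr => f _.
  have -> : BB (h f) = (-1) ^+ p * BB f.
    rewrite /BB -det_perm -det_mulmx -row_permE; congr (\det _).
    by apply/matrixP => i j; rewrite !mxE ffunE.
  rewrite mulrA [in RHS]mulrC mulrC; congr (_ * _); rewrite mulrC;
    congr (_ * _).
  by apply: eq_bigr => i _; rewrite ffunE.
rewrite -card_Sn -sum1_card natr_sum mulr_suml.
under eq_bigr => p _ do rewrite mul1r (permuted p).
rewrite exchange_big /=; apply: eq_bigr => f _; rewrite -mulr_suml;
  congr (_ * _).
rewrite /determinant big_mkcond /=; apply: eq_bigr => p _.
by congr (_ * _); apply: eq_bigr => i _; rewrite !mxE.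
Qed.

Section MatrixTree.
Context {R : realType} {G : multigraph}.
Local Notation V := (vertex G).
Local Notation E := (edge G).
Implicit Types (sigma : E -> R).

(** The incidence matrix of the chosen orientation, with integer entries. *)
Definition incz (e : E) (x : V) : int :=
  (x == (orient e).1)%:Z - (x == (orient e).2)%:Z.

Lemma incz_sum e : \sum_x incz e x = 0.
Proof.
have S a : \sum_x (x == a)%:Z = 1.
  by rewrite (bigD1 a) //= eqxx big1 ?addr0 // => i /negPf ->.
by rewrite sumrB !S subrr.
Qed.

Lemma incz_mul e x y : incz e x * incz e y =
  if x == y then (x \in ends e)%:Z else - (ends e == [set x; y])%:Z.
Proof.
rewrite /incz; have [<-|nxy] := eqVneq x y.
  rewrite ends_orient !inE; have := orient_neq e.
  case: (orient e) => a c /= nac.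
  case: (eqVneq x a) => [->|] //=; first by rewrite (negPf nac).
  by case: (x == c).
have -> : (ends e == [set x; y]) = (orient e == (x, y)) || (orient e == (y, x)).
  apply/eqP/orP => [/orientP[->|->]|[/eqP h|/eqP h]]; rewrite ?eqxx; auto.
    by rewrite ends_orient h.
  by rewrite ends_orient h setUC.
have := orient_neq e; case: (orient e) => a c /= nac; rewrite !xpair_eqE.
rewrite ![_ == x]eq_sym ![_ == y]eq_sym.
have [xa|xa] := eqVneq x a; have [xc|xc] := eqVneq x c;
have [ya|ya] := eqVneq y a; have [yc|yc] := eqVneq y c; subst => //=;
by rewrite ?eqxx in nac nxy *.
Qed.

Lemma walk_incz (F : {set E}) x y : connect (adj F) x y ->
  exists c : E -> int, forall v,
    \sum_(e in F) c e * incz e v = (v == y)%:Z - (v == x)%:Z.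
Proof.
case/connectP => p; elim: p x => [|z p IH] x /=.
  by move=> _ ->; exists (fun=> 0) => v; rewrite subrr big1 // => e _;
    rewrite mul0r.
move=> /andP[/adjP[e eF ee] hp] hy; have [c hc] := IH z hp hy.
pose k : int := if orient e == (x, z) then -1 else 1.
exists (fun e' => c e' + (e' == e)%:Z * k) => v.
under eq_bigr do rewrite mulrDl.
rewrite big_split /= hc (bigD1 e) //= eqxx mul1r big1 => [|e' /andP[_ /negPf
  ->]]; last first.
  by rewrite !mul0r.
rewrite addr0 /k /incz; case: (orientP ee) => -> /=.
  by rewrite eqxx; ring.
by rewrite xpair_eqE; have [->|_] := eqVneq z x; rewrite ?eqxx /=; ring.
Qed.

Section Reduced.
Variables (r : nat) (h : 'I_r.+1 -> V).
Hypothesis bij_h : bijective h.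
Hypothesis connG : connected_sub (whole G).

(* [h] enumerates the vertices; the first one is the root, and [g] enumerates
   the others. *)
Let root := h ord0.
Let g (i : 'I_r) := h (lift ord0 i).

Lemma card_vertex : #|V| = r.+1.
Proof. by rewrite -(bij_eq_card bij_h) card_ord. Qed.

Lemma reduced_onto x : x != root -> exists i, x = g i.
Proof.
case: bij_h => h' hK h'K nx; have [j|e] := unliftP ord0 (h' x).
  by move=> e; exists j; rewrite /g -e h'K.
by case/eqP: nx; rewrite /root -e h'K.
Qed.

Lemma g_root i : (g i == root) = false.
Proof. by apply/negP => /eqP/(bij_inj bij_h)/eqP;
  rewrite eq_sym (negPf (neq_lift _ _)). Qed.

Lemma g_inj : injective g.
Proof. by move=> i j /(bij_inj bij_h)/lift_inj. Qed.

Let Bf (f : {ffun 'I_r -> E}) : 'M[int]_r := \matrix_(i, j) incz (f i) (g j).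

(** For a tree, the paths from the root provide an integer inverse of the
reduced incidence matrix. *)
Lemma det_incz_tree (f : {ffun 'I_r -> E}) : injective f ->
  f @: setT \in spanning_trees G -> \det (Bf f) ^+ 2 = 1.
Proof.
move=> injf; rewrite inE => /andP[/andP[_ /forall_inP cT] _].
have path_to j : exists c : E -> int, forall v,
    \sum_(e in f @: setT) c e * incz e v = (v == g j)%:Z - (v == root)%:Z.
  by apply: walk_incz; have /forall_inP := cT root (in_setT _); apply;
    rewrite inE.
have [c hc] := choice path_to.
pose X : 'M[int]_r := \matrix_(i, j) c i (f j).
have XB : X *m Bf f = 1%:M.
  apply/matrixP => i j; rewrite !mxE natz; have := hc i (g j).
  rewrite big_imset /=; last by move=> a b _ _; apply: injf.
  rewrite g_root subr0 (inj_eq g_inj) [j == i]eq_sym => <-.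
  by apply: eq_big => [k|k _]; [rewrite inE | rewrite !mxE].
have := congr1 determinant XB; rewrite det_mulmx det1 => hd.
have /eqP := congr1 absz hd; rewrite abszM muln_eq1 => /andP[_].
by case: (\det (Bf f)) => [[|[|n]]|[|n]].
Qed.

(** Otherwise the indicator of the vertices not connected to the root is a
nonzero vector of the kernel. *)
Lemma det_incz_ntree (f : {ffun 'I_r -> E}) : injective f ->
  f @: setT \notin spanning_trees G -> \det (Bf f) = 0.
Proof.
move=> injf nT; set T := f @: setT in nT.
have cT : #|T| = r by rewrite card_imset // cardsT card_ord.
have : exists x, ~~ connect (adj T) root x.
  apply: contrapT => hN; case/negP: nT.
  apply: (tree_of_card connG); first by rewrite cT card_vertex.
  have all x : connect (adj T) root x by apply: contrapT => /negP hx;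
    apply: hN; exists x.
  apply/andP; split; first by apply/set0Pn; exists root.
  apply/forall_inP => x _; apply/forall_inP => y _.
  by apply: (@connect_trans _ _ root); rewrite // connect_adj_sym.
move=> [x0 nx0].
have [i0 ei0] : exists i, x0 = g i.
  by apply: reduced_onto; apply: contraNneq nx0 => ->; apply: connect0.
pose y : 'cV[int]_r := \col_j (~~ connect (adj T) root (g j))%:Z.
have By : Bf f *m y = 0.
  apply/matrixP => i j; rewrite !mxE.
  transitivity (\sum_x incz (f i) x * (~~ connect (adj T) root x)%:Z).
    rewrite (reindex h) /=; last exact: onW_bij.
    rewrite [RHS]big_ord_recl /= connect0 mulr0 add0r.
    by apply: eq_bigr => k _; rewrite !mxE.
  have fT : f i \in T by apply: imset_f; rewrite inE.
  have same : connect (adj T) root (orient (f i)).1 =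
      connect (adj T) root (orient (f i)).2.
    apply/idP/idP => /connect_trans; apply; apply: connect1;
      last rewrite adj_sym;
      by apply/adjP; exists (f i) => //; apply: ends_orient.
  have S a : \sum_x (x == a)%:Z * (~~ connect (adj T) root x)%:Z =
      (~~ connect (adj T) root a)%:Z.
    by rewrite (bigD1 a) //= eqxx mul1r big1 ?addr0 // => z /negPf ->;
      rewrite mul0r.
  rewrite /incz; under eq_bigr do rewrite mulrBl.
  by rewrite sumrB !S same subrr.
have := congr1 (mulmx (\adj (Bf f))) By; rewrite mulmxA mul_adj_mx mulmx0.
rewrite mul_scalar_mx => /matrixP/(_ i0 0); rewrite !mxE -ei0 nx0 mulr1.
by [].
Qed.

Lemma reduced_det sigma :
  \det (\matrix_(i < r, j < r) \sum_e sigma e * (incz e (g i))%:~R * (incz e (g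
    j))%:~R)
  = tree_sum sigma.
Proof.
have r0 : r`!%:R != 0 :> R by rewrite pnatr_eq0 -lt0n fact_gt0.
apply: (mulfI r0).
rewrite (cauchy_binet (fun i e => sigma e * (incz e (g i))%:~R)
  (fun e j => (incz e (g j))%:~R)).
have term (f : {ffun 'I_r -> E}) :
    \det (\matrix_(i, j) (sigma (f j) * (incz (f j) (g i))%:~R)) *
    \det (\matrix_(i, j) (incz (f i) (g j))%:~R) =
    if injectiveb f && (f @: setT \in spanning_trees G)
    then \prod_(e in f @: setT) sigma e else 0 :> R.
  have -> : \det (\matrix_(i, j) (incz (f i) (g j))%:~R) = (\det (Bf f))%:~R :>
    R.
    rewrite -det_map_mx; congr (\det _); apply/matrixP => i j; by rewrite !mxE.
  have -> : \det (\matrix_(i, j) (sigma (f j) * (incz (f j) (g i))%:~R)) =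
      \prod_i sigma (f i) * (\det (Bf f))%:~R.
    pose d := \row_i sigma (f i).
    rewrite -det_tr -det_map_mx.
    rewrite (_ : \prod_i _ = \det (diag_mx d)).
      rewrite -det_mulmx; congr (\det _); apply/matrixP => i j.
      by rewrite mul_diag_mx !mxE.
    by rewrite det_diag; apply: eq_bigr => i _; rewrite mxE.
  rewrite -mulrA -intrM -expr2.
  have [/injectiveP injf|ninj] := boolP (injectiveb f); last first.
    have /injectivePn[i [j nij eij]] := ninj.
    rewrite (determinant_alternate nij) ?expr0n ?mulr0 // => k.
    by rewrite !mxE eij.
  have [hT|nT] /= := boolP (f @: setT \in _).
    rewrite det_incz_tree // mulr1 big_imset /=; last by move=> a b _ _;
      apply: injf.
    by rewrite [RHS]big_mkcond /=; apply: eq_bigr => i _; rewrite inE.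
  by rewrite det_incz_ntree // expr0n mulr0.
under eq_bigr do rewrite term.
rewrite -big_mkcond /= (partition_big (fun f : {ffun 'I_r -> E} => f @: setT)
  (fun T => T \in spanning_trees G)) /=; last by move=> f /andP[].
rewrite /tree_sum mulr_sumr; apply: eq_bigr => T hT.
under eq_bigr => f /andP[_ /eqP ->] do [].
rewrite sumr_const [RHS]mulr_natl; congr (_ *+ _).
have cT : #|T| = r by have := card_tree connG hT; rewrite card_vertex => -[].
rewrite -[RHS]ffactnn -[X in _ = (X ^_ _)%N]cT -[X in _ = (_ ^_ X)%N](card_ord
  r).
rewrite -card_inj_ffuns_on; apply: eq_card => f; rewrite !inE.
rewrite [LHS]unfold_in.
have [injf|_] := boolP (injectiveb f); last by rewrite !andbF.
rewrite !andbT /=; apply/andP/forallP => [[_ /eqP <-] i|hf].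
  by rewrite imset_f ?inE.
have eT : f @: setT = T.
  apply/eqP; rewrite eqEcard card_imset ?cardsT ?card_ord ?cT ?leqnn ?andbT;
    last exact/injectiveP.
  by apply/subsetP => _ /imsetP[i _ ->].
by rewrite eT hT.
Qed.

(** The matrix tree theorem for a Laplacian indexed along [h]. *)
Lemma kirchhoff_index sigma (L : 'M[R]_r.+1) : (forall e, 0 < sigma e) ->
    (forall i j, L i j = \sum_e sigma e * (incz e (h i))%:~R * (incz e (h
      j))%:~R) ->
  0 < tree_sum sigma ->
  tree_sum sigma = r.+1%:R^-1 * det' L.
Proof.
move=> s0 LE ts0.
have eD : drsubmx (L : 'M_(1 + r)) = \matrix_(i < r, j < r)
    \sum_e sigma e * (incz e (g i))%:~R * (incz e (g j))%:~R.
  by apply/matrixP => i j; rewrite !mxE LE !rshift1.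
rewrite (@det'_zero_sums _ r L) ?eD ?reduced_det ?gt_eqF //.
- by rewrite mulKf // pnatr_eq0.
- by apply/matrixP => i j; rewrite mxE !LE; apply: eq_bigr => e _;
  rewrite mulrAC.
- move=> i; under eq_bigr do rewrite LE.
  rewrite exchange_big /= big1 // => e _; rewrite -mulr_sumr.
  rewrite -rmorph_sum /= (_ : \sum_(j < r.+1) incz e (h j) = 0) ?mulr0 //.
  by rewrite -[RHS](incz_sum e) [RHS](reindex h) //; apply: onW_bij.
move=> v; pose q e := \sum_i v 0 i * (incz e (h i))%:~R.
have -> : (v *m L *m v^T) 0 0 = \sum_e sigma e * q e ^+ 2.
  rewrite !mxE.
  transitivity (\sum_e \sum_j \sum_i sigma e * (v 0 i * (incz e (h i))%:~R) *
      (v 0 j * (incz e (h j))%:~R)).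
    rewrite exchange_big /=; apply: eq_bigr => j _; rewrite !mxE.
    rewrite exchange_big mulr_suml /=; apply: eq_bigr => i _.
    by rewrite LE mulr_sumr mulr_suml; apply: eq_bigr => e _; ring.
  apply: eq_bigr => e _; rewrite expr2 mulrA {1}/q mulr_sumr mulr_suml.
  rewrite exchange_big /=; apply: eq_bigr => i _; rewrite /q mulr_sumr.
  by apply: eq_bigr => j _; ring.
by apply: sumr_ge0 => e _; rewrite mulr_ge0 ?sqr_ge0 // ltW.
Qed.

End Reduced.

Lemma laplacianE sigma i j : laplacian sigma i j = \sum_e sigma e *
  (incz e (enum_val i))%:~R * (incz e (enum_val j))%:~R.
Proof.
have m e : sigma e * (incz e (enum_val i))%:~R * (incz e (enum_val j))%:~R =
   sigma e * (incz e (enum_val i) * incz e (enum_val j))%:~R.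
  by rewrite intrM mulrA.
under eq_bigr do rewrite m incz_mul (inj_eq enum_val_inj).
rewrite mxE; case: eqP => _.
  by rewrite big_mkcond; apply: eq_bigr => e _; case: ifP;
    rewrite ?mulr1 ?mulr0.
rewrite big_mkcond -sumrN; apply: eq_bigr => e _.
by case: ifP; rewrite ?oppr0 ?mulr0 // mulrN1z mulrN1.
Qed.

Lemma kirchhoff sigma : connected_sub (whole G) -> (forall e, 0 < sigma e) ->
  tree_sum sigma = #|V|%:R^-1 * det' (laplacian sigma).
Proof.
move=> connG s0.
have ts0 : 0 < tree_sum sigma.
  have [T hT _] := tree_extend connG (indep0 (@inc G)).
  rewrite /tree_sum (bigD1 T) //= ltr_pwDl ?prodr_gt0 // sumr_ge0 // => U _.
  by apply: prodr_ge0 => e _; apply: ltW.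
suff gen n (h : 'I_n -> V) (L : 'M[R]_n) : bijective h ->
    (forall i j, L i j = \sum_e sigma e * (incz e (h i))%:~R * (incz e (h
      j))%:~R) ->
    tree_sum sigma = n%:R^-1 * det' L.
  by apply: (gen _ enum_val) (laplacianE sigma); apply: enum_val_bij.
case: n h L => [|r] h L bh LE; last exact: (kirchhoff_index bh).
by have := rk_whole connG; rewrite -(bij_eq_card bh) card_ord.
Qed.

End MatrixTree.

(** * The theorem *)

Theorem theorem1p15 (R : realType) (G : multigraph) (beta : edge G -> R)
    (connG : connected_sub (whole G)) (pmf_beta : positive_pmf beta) :
  [/\ forall sigma : edge G -> R, (forall e, 0 < sigma e) ->
        tree_sum sigma = #|vertex G|%:R^-1 * det' (laplacian sigma),
      0 < inf [set tree_sum sigma | sigma in feasible beta]%classic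
        <-> beta_dense beta (whole G)
    & (exists2 sigma, feasible beta sigma &
         forall tau, feasible beta tau -> tree_sum sigma <= tree_sum tau)
        <-> beta_dense beta (whole G) /\
            (forall K : subgraph G, block K -> strictly_beta_dense beta K)].
Proof.
have bd := beta_denseP connG pmf_beta; split=> [sigma||].
- exact: kirchhoff connG.
- by rewrite bd; apply: inf_gt0_dense.
- by rewrite bd minimiser_iff //; apply: minimiser_dense_blocks.
Qed.
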